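(* Let $\Sigma\subset\mathbb R^2$ and $p\in[1,+\infty]$. Then, for every $(z_0,z_1)\in\mathsf X_p$, there exists a unique solution in $\mathsf X_p$ of the wave equation associated with $\Sigma$ with initial condition $(z_0,z_1)$ if and only if one of the following holds: either $p<+\infty$ and $R\Sigma$ is equal to the graph of a universally measurable function $\varphi:\mathbb R\to\mathbb R$ with linear growth, or $p=+\infty$ and $R\Sigma$ is equal to the graph of a universally measurable function $\varphi:\mathbb R\to\mathbb R$ mapping bounded sets to bounded sets.
   Context: Notation: $\mathbb R_+=[0,+\infty)$, $R=\begin{pmatrix}\frac1{\sqrt2}&\frac1{\sqrt2}\\-\frac1{\sqrt2}&\frac1{\sqrt2}\end{pmatrix}$ and $R\Sigma=\{R\xi:\xi\in\Sigma\}$. $L^p_{\mathrm{loc}}(a,+\infty)$ is the set of measurable functions whose restriction to $(a,T)$ is in $L^p$ for every $T>a$. $W^{1,p}_*(0,1)=\{u\in L^p(0,1): u'\in L^p(0,1),\ u(0)=0\}$ and $\mathsf X_p=W^{1,p}_*(0,1)\times L^p(0,1)$. The wave equation associated with $\Sigma$ is: $z_{tt}=z_{xx}$ on $\mathbb R_+\times[0,1]$; $z(t,0)=0$ and $(z_t(t,1),-z_x(t,1))\in\Sigma$ for $t\in\mathbb R_+$; $z(0,x)=z_0(x)$, $z_t(0,x)=z_1(x)$ for $x\in[0,1]$. A (weak, global in time) solution in $\mathsf X_p$ with initial condition $(z_0,z_1)\in\mathsf X_p$ is a function $z:\mathbb R_+\times[0,1]\to\mathbb R$ for which there exist $f\in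 L^p_{\mathrm{loc}}(0,+\infty)$ and $g\in L^p_{\mathrm{loc}}(-1,+\infty)$ such that $z(t,x)=\frac1{\sqrt2}\int_0^{t+x}f+\frac1{\sqrt2}\int_0^{t-x}g$ for all $(t,x)\in\mathbb R_+\times[0,1]$, $z(t,0)=0$ and $(z_t(t,1),-z_x(t,1))\in\Sigma$ for a.e. $t\in\mathbb R_+$, and $z(0,x)=z_0(x)$, $z_t(0,x)=z_1(x)$ for a.e. $x\in[0,1]$; here $z_t(t,x)=\frac{f(t+x)+g(t-x)}{\sqrt2}$ and $z_x(t,x)=\frac{f(t+x)-g(t-x)}{\sqrt2}$. A function $\varphi:\mathbb R\to\mathbb R$ has linear growth if there exist $a,b\in\mathbb R_+$ with $|\varphi(x)|\le a|x|+b$ for all $x\in\mathbb R$. A set $M\subset\mathbb R$ is universally measurable if for every Borel probability measure $\nu$ on $\mathbb R$ there exist Borel sets $A\subset M\subset B$ with $\nu(B\setminus A)=0$; a function $\varphi:\mathbb R\to\mathbb R$ is universally measurable if $\varphi^{-1}(B)$ is universally measurable for every Borel set $B\subset\mathbb R$. *)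

(* Defs.v *)
From HB Require Import structures.
From mathcomp Require Import all_boot all_order all_algebra.
From mathcomp Require Import all_classical all_reals all_analysis.

Set Implicit Arguments.
Unset Strict Implicit.
Unset Printing Implicit Defensive.

Import Order.TTheory GRing.Theory Num.Theory.
Import numFieldNormedType.Exports.

Local Open Scope classical_set_scope.
Local Open Scope ring_scope.

(* "Measurable", "integral" and "a.e." refer to the Lebesgue (i.e. completed)
   sigma-algebra on the domain: composing a Borel function with a universally
   measurable one yields a function which is Lebesgue, but in general not
   Borel, measurable. *)
Definition leb (R : realType) : {measure set _ -> \bar R} :=
  @completed_lebesgue_measure R.

(* Elements of L^p are represented by genuine functions, defined on the whole
   line and used only on [D]; [f \_ D] extends [f] by 0 outside [D]. *)
Definition Lp (R : realType) (p : \bar R) (D : set R) (f : R -> R) : Prop :=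
  f \_ D \in Lfun (leb R) p.

Definition Lploc (R : realType) (p : \bar R) (a : R) (f : R -> R) : Prop :=
  forall T, a < T -> Lp p `]a, T[ f.

(* C^1_c(0,1) is enough to test weak derivatives in one dimension (as in
   Brezis, Functional Analysis, Sobolev Spaces and PDE, Section 8.2). *)
Definition test_function (R : realType) (phi : R -> R) : Prop :=
  [/\ forall x, derivable phi x 1,
      continuous (derive1 phi) &
      exists K : set R,
        [/\ compact K, K `<=` `]0, 1[ & forall x, ~ K x -> phi x = 0]].

Definition weak_derivative (R : realType) (u h : R -> R) : Prop :=
  forall phi, test_function phi ->
    \int[leb R]_(x in `]0, 1[) (u x * derive1 phi x) =
    - \int[leb R]_(x in `]0, 1[) (h x * phi x).

(* W^{1,p}_*(0,1): a Sobolev function is identified with its continuous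
   representative on [0, 1], which gives a meaning to [u 0 = 0]. *)
Definition W1p0 (R : realType) (p : \bar R) (u : R -> R) : Prop :=
  [/\ {within `[0, 1], continuous u},
      Lp p `]0, 1[ u,
      exists h, Lp p `]0, 1[ h /\ weak_derivative u h &
      u 0 = 0].

Definition Xp (R : realType) (p : \bar R) (z0 z1 : R -> R) : Prop :=
  W1p0 p z0 /\ Lp p `]0, 1[ z1.

(* Oriented: [b < a] is allowed. *)
Definition oint (R : realType) (f : R -> R) (a b : R) : R :=
  if a <= b then \int[leb R]_(x in `[a, b]) f x
  else - \int[leb R]_(x in `[b, a]) f x.

Definition dt (R : realType) (f g : R -> R) (t x : R) : R :=
  (f (t + x) + g (t - x)) / Num.sqrt 2.

Definition dx (R : realType) (f g : R -> R) (t x : R) : R :=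
  (f (t + x) - g (t - x)) / Num.sqrt 2.

(* Only the values of [z] on [0, +oo[ x [0, 1] are relevant. *)
Definition wave_solution (R : realType) (Sigma : set (R * R)) (p : \bar R)
    (z0 z1 : R -> R) (z : R -> R -> R) : Prop :=
  exists f g : R -> R,
    [/\ Lploc p 0 f /\ Lploc p (-1) g,
        forall t x, 0 <= t -> 0 <= x <= 1 ->
          z t x = 1 / Num.sqrt 2 * oint f 0 (t + x)
                + 1 / Num.sqrt 2 * oint g 0 (t - x),
        {ae leb R, forall t : R, 0 <= t ->
          z t 0 = 0 /\ Sigma (dt f g t 1, - dx f g t 1)} &
        {ae leb R, forall x : R, 0 <= x <= 1 ->
          z 0 x = z0 x /\ dt f g 0 x = z1 x}].

Definition exists_unique_solution (R : realType) (Sigma : set (R * R))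
    (p : \bar R) (z0 z1 : R -> R) : Prop :=
  exists z, wave_solution Sigma p z0 z1 z /\
    forall z', wave_solution Sigma p z0 z1 z' ->
      forall t x, 0 <= t -> 0 <= x <= 1 -> z' t x = z t x.

Definition rot45 (R : realType) (xi : R * R) : R * R :=
  (1 / Num.sqrt 2 * xi.1 + 1 / Num.sqrt 2 * xi.2,
   - (1 / Num.sqrt 2) * xi.1 + 1 / Num.sqrt 2 * xi.2).

Definition fun_graph (R : realType) (phi : R -> R) : set (R * R) :=
  [set xi | xi.2 = phi xi.1].

Definition linear_growth (R : realType) (phi : R -> R) : Prop :=
  exists a b : R, [/\ 0 <= a, 0 <= b & forall x, `|phi x| <= a * `|x| + b].

Definition bounded_to_bounded (R : realType) (phi : R -> R) : Prop :=
  forall A : set R, bounded_set A -> bounded_set (phi @` A).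

(* [measurableTypeR R] is the line with its Borel sigma-algebra. *)
Definition universally_measurable_set (R : realType) (M : set R) : Prop :=
  forall nu : probability (measurableTypeR R) R,
    exists A B : set (measurableTypeR R),
      [/\ measurable A, measurable B, A `<=` M, M `<=` B &
          nu (B `\` A) = 0%E].

Definition universally_measurable_fun (R : realType) (phi : R -> R) : Prop :=
  forall B : set (measurableTypeR R), measurable B ->
    universally_measurable_set (phi @^-1` B).

(* Main.v *)
Require Import Defs.
From HB Require Import structures.
From mathcomp Require Import all_boot all_order all_algebra.
From mathcomp Require Import all_classical all_reals all_analysis.
From mathcomp Require Import measurable_realfun ess_sup_inf ring lra.

(** d'Alembert's formula turns the wave equation into a recursion for a single
    function [g] on ]-1, +oo[.

    Let [z] be a solution given by [f] and [g]. The condition at x = 0 says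
    that the primitive of [f + g] vanishes a.e., hence [f = - g] on ]0, +oo[
    ([vanishing_ae]), so that z(t, x) is - 1 / sqrt 2 times the integral of [g]
    over ]t - x, t + x[. The rotation R maps (z_t(t, 1), - z_x(t, 1)) to
    (g(t - 1), - f(t + 1)) = (g(t - 1), g(t + 1)), and the initial data
    prescribe [g] on ]-1, 1[. Solving the wave equation thus amounts to
    finding [g] in L^p_loc with prescribed values on ]-1, 1[ and
    (g(t - 1), g(t + 1)) in R Sigma for a.e. t >= 0
    ([trace_solution_wave], [wave_trace_solution]).

    Sufficiency. If R Sigma is the graph of phi, this is the recursion
    g(s + 2) = phi(g(s)), which determines [g] on successive blocks of length
    two ([unroll], [trace_solution_unique]). Its iterates have to remain in
    L^p. They are measurable because the law of a measurable function is a
    Borel measure, for which phi is measurable up to null sets ([um_comp]);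
    the growth condition gives the bound. The datum [z0] enters through its
    weak derivative, which has to integrate back to [z0]
    ([weak_derivative_primitive]).

    Necessity. For z0 = 0 and z1 = sqrt 2 * f one gets g(-x) = f(x) on ]0, 1[,
    and k(x) = g(2 - x) is then a function in L^p(0, 1) with (f, k) in R Sigma
    a.e. ([trace_response]). Constant functions [f] show that R Sigma meets
    every vertical line. It meets each only once: if (c, y1) and (c, y2) were
    two points of R Sigma, following the one or the other would give two
    solutions for the same data ([trace_functional]). So R Sigma is the graph
    of some phi for which phi \o f is in L^p(0, 1) whenever [f] is, and this
    stability has two consequences.

    - Growth: otherwise a function made of countably many spikes, with suitable
      heights and widths, is in L^p while its image by phi is not
      ([stable_linear_growth], [stable_bounded]).

    - Universal measurability ([stable_universally_measurable]): a probability
      nu on the line is the law of its quantile function [q] on ]0, 1[, and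
      phi \o q is Lebesgue measurable by stability. For a Borel set [B], Lusin's
      theorem shows that the images by [q] of the set where phi \o q is in [B]
      and of its complement contain Borel sets that together have full measure
      for nu, and these enclose the preimage of [B] by phi. *)

Set Implicit Arguments.
Unset Strict Implicit.
Unset Printing Implicit Defensive.

Import Order.TTheory GRing.Theory Num.Theory.
Import numFieldNormedType.Exports.

Local Open Scope classical_set_scope.
Local Open Scope ring_scope.

(** * Lebesgue measurable sets of the line *)

Section CompletedLebesgue.
Context {R : realType}.
Implicit Types (A D E N : set R) (f g : R -> R).

(** The line with the sigma-algebra on which [leb] is defined. The carrier
    [R] being also that of the Borel structure, the structure has to be given
    explicitly throughout. *)
Definition lebT : measurableType _ :=
  caratheodory_type ((@wlength R idfun)^*)%mu.

Local Notation mu := (leb R).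
Local Notation mes D := (@measurable _ lebT D).

Lemma borel_leb A : @measurable _ (measurableTypeR R) A -> mes A.
Proof. exact: sub_caratheodory. Qed.

Lemma borel_mfun A f : @measurable _ (measurableTypeR R) A ->
  @measurable_fun _ _ (measurableTypeR R) R A f ->
  @measurable_fun _ _ lebT R A f.
Proof. by move=> mA mf _ Y mY; apply: borel_leb; exact: mf. Qed.

Lemma leb_itv_mes (i : interval R) : mes [set` i].
Proof. by apply: borel_leb; exact: measurable_itv. Qed.

Lemma leb_itvE (i : interval R) :
  mu [set` i] = (if i.1 < i.2 then (i.2 : \bar R) - i.1 else 0)%E.
Proof. exact: (lebesgue_measure_itv i). Qed.

Lemma leb_oo (a b : R) : a <= b -> mu `]a, b[%classic = (b - a)%:E.
Proof.
move=> ab; rewrite leb_itvE/= lte_fin EFinB.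
by case: ltgtP ab => // -> _; rewrite subee.
Qed.

Lemma leb_null_mes N : mu.-negligible N -> mes N.
Proof. exact: completed_lebesgue_measure_is_complete. Qed.

(** Completion only adds null sets. This reduces Lebesgue measurable sets to
    Borel sets, for which measures are determined by their values on intervals
    and Lusin's theorem holds. *)
Lemma leb_decomp E : mes E ->
  exists A N, [/\ @measurable _ (measurableTypeR R) A, mu.-negligible N,
    (@lebesgue_measure R).-negligible N & E = A `|` N].
Proof.
move=> mE.
have : (completed_algebra_gen (@lebesgue_measure R)).-sigma.-measurable E.
  by rewrite completed_caratheodory_measurable.
rewrite g_sigma_completed_algebra_genE => -[/= A mA [N nN AN]].
exists A, N; split => //.
by case: nN => B [mB B0 NB]; exists B; split => //; exact: borel_leb.
Qed.

End CompletedLebesgue.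
Arguments lebT R : clear implicits.

(** * Reflections and translations *)

Section Affine.
Context {R : realType}.
Implicit Types (A D E N : set R) (f g : R -> R) (s c : R).
Local Notation mu := (leb R).
Local Notation mes D := (@measurable _ (lebT R) D).
Local Notation mfun D f := (@measurable_fun _ _ (lebT R) R D f).

(** Used with [s] equal to 1 or -1 only, where it preserves the measure: the two
    waves move along x = c - t and x = c + t, and the data at time 0 see both
    [g x] and [g (- x)]. *)
Definition aff s c (x : R) := s * x + c.

Lemma aff_measurable s c :
  @measurable_fun _ _ (measurableTypeR R) (measurableTypeR R) setT (aff s c).
Proof.
apply: (@measurable_funD _ (measurableTypeR R) R setT) => //.
Qed.

(** The image measure agrees with Lebesgue measure on bounded intervals, and
    Lebesgue measure is characterized by these values. *)
Lemma lebesgue_measure_aff s c A : s = 1 \/ s = -1 ->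
  @measurable _ (measurableTypeR R) A ->
  @lebesgue_measure R (aff s c @^-1` A) = @lebesgue_measure R A.
Proof.
move=> hs mA.
transitivity (pushforward (@lebesgue_measure R)
  (aff s c : measurableTypeR R -> measurableTypeR R) A) => //.
apply/esym/lebesgue_measure_unique => //=; first exact: aff_measurable.
move=> _ X [[a b]] _ <- /=; rewrite /pushforward /=.
case: hs => ->.
  rewrite [X in _ = lebesgue_measure X](_ : _ = `]a - c, b - c]%classic); last first.
    by apply/seteqP; split => x /=; rewrite /aff !in_itv/= mul1r ltrBlDr lerBrDr.
  by rewrite !lebesgue_measure_itv/= !lte_fin ltrD2r -!EFinB opprB addrA subrK.
rewrite [X in _ = lebesgue_measure X](_ : _ = `[c - b, c - a[%classic); last first.
  apply/seteqP; split => x /=; rewrite /aff !in_itv/= mulN1r => /andP[ax xb]; apply/andP; split; lra.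
rewrite !lebesgue_measure_itv/= !lte_fin ltrD2l ltrN2 -!EFinB.
by congr (if _ then (_)%:E else _); lra.
Qed.

(** In a decomposition of a null Lebesgue set into a Borel set and a set that
    is negligible for the Borel measure, the Borel set is null as well. *)
Lemma leb_negl_lebesgue N : mu.-negligible N -> (@lebesgue_measure R).-negligible N.
Proof.
move=> [B [mB B0 NB]].
have [A [M [mA nM [C [mC C0 MC]] BE]]] := leb_decomp mB.
exists (A `|` C); split.
- exact: measurableU.
- apply/eqP; rewrite eq_le measure_ge0 andbT.
  have := measureU2 (@lebesgue_measure R) mA mC; rewrite [X in (_ + X)%E]C0 adde0 => /le_trans; apply.
  rewrite -[leRHS]B0 -[mu B]/(@lebesgue_measure R B).
  apply: (@le_measure _ _ _ mu); rewrite ?inE//; first exact: borel_leb.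
  by rewrite BE; exact: subsetUl.
- by apply: (subset_trans NB); rewrite BE; exact: setUS.
Qed.

Lemma leb_aff_negl s c N : s = 1 \/ s = -1 ->
  mu.-negligible N -> mu.-negligible (aff s c @^-1` N).
Proof.
move=> hs /leb_negl_lebesgue [B [mB B0 NB]].
exists (aff s c @^-1` B); split.
- by apply: borel_leb; rewrite -[X in measurable X]setTI; exact: aff_measurable.
- exact: etrans (lebesgue_measure_aff c hs mB) B0.
- by move=> x /NB.
Qed.

Lemma leb_aff_mes s c A : s = 1 \/ s = -1 -> mes A -> mes (aff s c @^-1` A).
Proof.
move=> hs /leb_decomp[B [N [mB nN _ ->]]].
rewrite preimage_setU; apply: measurableU.
  by apply: borel_leb; rewrite -[X in measurable X]setTI; exact: aff_measurable.
by apply: leb_null_mes; exact: leb_aff_negl.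
Qed.

Lemma leb_aff s c A : s = 1 \/ s = -1 -> mes A -> mu (aff s c @^-1` A) = mu A.
Proof.
move=> hs /leb_decomp[B [N [mB nN _ ->]]].
have mN := leb_null_mes nN.
have aN := leb_aff_negl c hs nN.
have maN := leb_null_mes aN.
have maB : mes (aff s c @^-1` B).
  by apply: borel_leb; rewrite -[X in measurable X]setTI; exact: aff_measurable.
have nullU X Y : mes X -> mes Y -> mu.-negligible Y -> mu (X `|` Y) = mu X.
  move=> mX mY /(negligibleP _ mY) Y0.
  by rewrite measureU0.
rewrite preimage_setU !nullU//; last exact: borel_leb.
exact: (lebesgue_measure_aff c hs mB).
Qed.

Lemma aff_mfun s c : s = 1 \/ s = -1 ->
  @measurable_fun _ _ (lebT R) (lebT R) setT (aff s c).
Proof. by move=> hs _ A mA; rewrite setTI; exact: leb_aff_mes. Qed.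

Lemma mfun_aff s c D f : s = 1 \/ s = -1 -> mes D ->
  mfun D f -> mfun (aff s c @^-1` D) (f \o aff s c).
Proof.
move=> hs mD mf _ B mB.
rewrite (_ : _ `&` _ = aff s c @^-1` (D `&` f @^-1` B)).
  by apply: leb_aff_mes => //; exact: mf.
by rewrite preimage_setI.
Qed.

(** The measure preserving map [aff s c] carries [leb] to itself. *)
Lemma leb_ge0_subst s c D (h : R -> \bar R) : s = 1 \/ s = -1 -> mes D ->
  @measurable_fun _ _ (lebT R) _ D h -> (forall x, D x -> (0 <= h x)%E) ->
  (\int[mu]_(x in aff s c @^-1` D) h (aff s c x) = \int[mu]_(x in D) h x)%E.
Proof.
move=> hs mD mh h0.
have := @ge0_integral_pushforward _ _ (lebT R) (lebT R) R (aff s c)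
  (aff_mfun c hs) mu D h mD mh.
move=> <-; last by move=> x /set_mem; exact: h0.
by apply: eq_measure_integral => //=; [exact: aff_mfun|] => _ A mA _; exact: leb_aff.
Qed.

Lemma leb_integrable_aff s c D f : s = 1 \/ s = -1 -> mes D ->
  mu.-integrable D (EFin \o f) ->
  mu.-integrable (aff s c @^-1` D) (EFin \o (f \o aff s c)).
Proof.
move=> hs mD /integrableP[/measurable_EFinP mf foo]; apply/integrableP; split.
  by apply/measurable_EFinP; exact: mfun_aff.
rewrite (leb_ge0_subst _ (h := fun x => `|(f x)%:E|%E))//.
by apply: measurableT_comp => //; exact/measurable_EFinP.
Qed.

Lemma leb_subst s c D f : s = 1 \/ s = -1 -> mes D ->
  mu.-integrable D (EFin \o f) ->
  \int[mu]_(x in aff s c @^-1` D) f (aff s c x) = \int[mu]_(x in D) f x.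
Proof.
move=> hs mD fi; have [mf _] := integrableP _ _ _ fi.
rewrite /Rintegral; congr fine.
rewrite integralE [RHS]integralE; congr (_ - _)%E.
- rewrite -(leb_ge0_subst c hs mD (h := (EFin \o f)^\+%E))//.
  by apply: eq_integral => x _; rewrite !funeposE. exact: measurable_funepos.
- rewrite -(leb_ge0_subst c hs mD (h := (EFin \o f)^\-%E))//.
  by apply: eq_integral => x _; rewrite !funenegE. exact: measurable_funeneg.
Qed.

Lemma aeS (P Q : R -> Prop) : (forall x, P x -> Q x) ->
  {ae mu, forall x, P x} -> {ae mu, forall x, Q x}.
Proof. by move=> PQ; apply: negligibleS => x /= + /PQ. Qed.

Lemma aeS2 (P Q S : R -> Prop) : (forall x, P x -> Q x -> S x) ->
  {ae mu, forall x, P x} -> {ae mu, forall x, Q x} -> {ae mu, forall x, S x}.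
Proof.
move=> PQS hP hQ; apply: negligibleS (negligibleU hP hQ) => x /= nS.
by apply: contrapT => /not_orP[/contrapT + /contrapT]; move=> /PQS + Qx => /(_ Qx).
Qed.

Lemma aeT (P : R -> Prop) : (forall x, P x) -> {ae mu, forall x, P x}.
Proof. by move=> hP; apply: negligibleS (negligible_set0 mu) => x; apply. Qed.

(** Preimages of null sets by [aff s c] are null. *)
Lemma ae_aff s c (P : R -> Prop) : s = 1 \/ s = -1 ->
  {ae mu, forall x, P x} -> {ae mu, forall x, P (aff s c x)}.
Proof. by move=> hs hP; exact: (leb_aff_negl c hs hP). Qed.

End Affine.

(** * The spaces L^p on subsets of the line *)

Section AbstractLfun.
Context d (T : measurableType d) (R : realType) (mu : {measure set T -> \bar R}).
Hypothesis mu0 : (0 < mu [set: T])%E.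
Implicit Types (g h : T -> R) (p : \bar R).

Lemma in_LfunE p h : h \in Lfun mu p <-> measurable_fun setT h /\ finite_norm mu p h.
Proof.
split; first by rewrite inE => /andP[/[1!inE]/= mh /[1!inE]/= nh].
by move=> [mh nh]; rewrite inE; apply/andP; split; rewrite inE/=.
Qed.

Lemma powR_measurable (D : set T) r h : measurable_fun D h ->
  measurable_fun D (fun x => (`|h x| `^ r)%:E).
Proof.
move=> mh; apply/measurable_EFinP.
apply: (measurableT_comp (measurable_powR _)) => //.
exact: measurableT_comp.
Qed.

Lemma finite_norm_fin r h : 1 <= r ->
  finite_norm mu r%:E h <-> (\int[mu]_x (`|h x| `^ r)%:E < +oo)%E.
Proof.
move=> r1; have r0 : r != 0 by rewrite gt_eqF// (lt_le_trans ltr01).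
rewrite /finite_norm unlock /Lnorm; split.
  by apply: lty_poweRy; rewrite invr_eq0.
by move=> fin; rewrite poweR_lty.
Qed.

Lemma finite_norm_oo h :
  finite_norm mu +oo%E h <-> exists M, {ae mu, forall x, `|h x| <= M}.
Proof.
rewrite /finite_norm unlock /Lnorm mu0; split.
  move=> /ess_supr_bounded[M hM]; exists M.
  by apply: filterS hM => x.
move=> [M hM]; apply: (@le_lt_trans _ _ M%:E); last exact: ltry.
by apply/ess_supP; apply: filterS hM => x; rewrite /= lee_fin.
Qed.

Lemma Lfun_mono p g h : (1 <= p)%E -> h \in Lfun mu p -> measurable_fun setT g ->
  {ae mu, forall x, `|g x| <= `|h x|} -> g \in Lfun mu p.
Proof.
move=> p1 /in_LfunE[mh nh] mg gh; apply/in_LfunE; split => //.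
case: p p1 nh => [r r1| _|//].
- move=> /(finite_norm_fin _ r1) fin; apply/(finite_norm_fin _ r1).
  apply: le_lt_trans fin.
  apply: ae_ge0_le_integral => //.
  + exact: powR_measurable.
  + exact: powR_measurable.
  + apply: filterS gh => x ghx _; rewrite lee_fin ge0_ler_powR// ?nnegrE//.
    exact: (le_trans ler01).
- move=> /finite_norm_oo[M hM]; apply/finite_norm_oo; exists M.
  by apply: filterS2 gh hM => x; exact: le_trans.
Qed.

End AbstractLfun.

Section LebesgueSpaces.
Context {R : realType}.
Implicit Types (A D E N : set R) (f g h : R -> R) (p : \bar R).
Local Notation mu := (leb R).
Local Notation mes D := (@measurable _ (lebT R) D).
Local Notation mfun D f := (@measurable_fun _ _ (lebT R) R D f).

Lemma leb_gt0 : (0 < mu [set: R])%E.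
Proof.
have -> : [set: R] = [set` `]-oo, +oo[ : interval R]
  by rewrite set_itvE.
by rewrite leb_itvE/= addye ?ltry.
Qed.

Lemma mfun_restr D f : mes D -> mfun D f -> mfun setT (f \_ D).
Proof. by move=> mD; exact: (@measurable_restrictT _ _ (lebT R) _ D f mD).1. Qed.

Lemma Lp_mfun p D f : mes D -> Lp p D f -> mfun D f.
Proof. move=> mD /in_LfunE[mf _].
exact: (@measurable_restrictT _ _ (lebT R) _ D f mD).2.
Qed.

(** The comparison on which proofs of membership in L^p rest. The two sets may
    differ, which covers restrictions too. *)
Lemma Lp_mono p D E f g : (1 <= p)%E -> mes E -> mfun E g -> Lp p D f ->
  {ae mu, forall x, E x -> D x /\ `|g x| <= `|f x|} -> Lp p E g.
Proof.
move=> p1 mE mg Lf gf; apply: (Lfun_mono leb_gt0 p1 Lf); first exact: mfun_restr.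
apply: aeS gf => x gfx; rewrite !patchE; case: ifPn => [|_].
  by rewrite inE => Ex; have [Dx ?] := gfx Ex; rewrite mem_set.
by rewrite normr0.
Qed.

Lemma Lp_sub p D E f : (1 <= p)%E -> mes D -> mes E -> E `<=` D ->
  Lp p D f -> Lp p E f.
Proof.
move=> p1 mD mE ED Lf; apply: (Lp_mono p1 mE _ Lf).
  apply: (measurable_funS mD ED); exact: Lp_mfun Lf.
by apply: aeT => x /ED.
Qed.

Lemma mfun_ae D f g : mes D -> {ae mu, forall x, D x -> f x = g x} ->
  mfun D f -> mfun D g.
Proof.
move=> mD fg mf.
apply/measurable_EFinP.
have c := @completed_lebesgue_measure_is_complete R.
apply: (ae_measurable_fun (mu := mu) c (f := EFin \o f)).
  by apply: aeS fg => x fg Dx; rewrite /= fg.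
exact/measurable_EFinP.
Qed.

Lemma Lp_ae p D f g : (1 <= p)%E -> mes D ->
  {ae mu, forall x, D x -> f x = g x} -> Lp p D f -> Lp p D g.
Proof.
move=> p1 mD fg Lf; apply: (Lp_mono p1 mD _ Lf).
  by apply: (mfun_ae mD fg); exact: Lp_mfun Lf.
by apply: aeS fg => x fgx Dx; rewrite fgx.
Qed.

Lemma Lp_eq p D f g : {in D, f =1 g} -> Lp p D f -> Lp p D g.
Proof.
move=> fg; rewrite /Lp (_ : f \_ D = g \_ D)//.
by apply/funext => x; rewrite !patchE; case: ifPn => // /fg.
Qed.

Lemma LpD p D f g : (1 <= p)%E -> Lp p D f -> Lp p D g -> Lp p D (f \+ g).
Proof.
move=> p1 Lf Lg; rewrite /Lp.
rewrite (_ : _ \_ D = f \_ D \+ g \_ D); last first.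
  by apply/funext => x; rewrite /= !patchE; case: ifP => //; rewrite addr0.
by have := Lfun_addr_closed mu p1; move=> [_ /(_ _ _ Lf Lg)].
Qed.

Lemma LpZ p D f a : (1 <= p)%E -> Lp p D f -> Lp p D (fun x => a * f x).
Proof.
move=> p1 Lf; rewrite /Lp.
have [L0 LZ] := Lfun_submod_closed mu p1.
rewrite (_ : _ \_ D = a *: (f \_ D) + 0); first exact: LZ.
apply/funext => x; rewrite addr0 /= fctE !patchE.
by case: ifP => //; rewrite scaler0.
Qed.

Lemma Lp0 p D : (1 <= p)%E -> Lp p D (cst 0).
Proof.
move=> p1; have [L0 _] := Lfun_submod_closed mu p1.
by rewrite /Lp (_ : _ \_ D = 0)//; apply/funext => x; rewrite patchE; case: ifP.
Qed.

Lemma Lp_cst p D c : (1 <= p)%E -> mes D -> (mu D < +oo)%E -> Lp p D (cst c).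
Proof.
move=> p1 mD Doo; apply/in_LfunE; split; first by exact: mfun_restr.
case: p p1 => [r r1|_|//].
- rewrite finite_norm_fin//.
  have r0 : r != 0 by rewrite gt_eqF// (lt_le_trans ltr01).
  rewrite (_ : (fun x => _) = (fun x => (`|c| `^ r)%:E) \_ D); last first.
    apply/funext => x; rewrite !patchE; case: ifP => //.
    by rewrite normr0 powR0.
  rewrite -integral_mkcond integral_cst// lte_mul_pinfty//.
- apply/(finite_norm_oo leb_gt0); exists `|c|; apply: aeT => x; rewrite patchE.
  by case: ifP; rewrite ?normr0.
Qed.

Lemma mfun_norm D f : mfun D f -> mfun D (fun x => `|f x|).
Proof. by move=> mf; exact: measurableT_comp. Qed.

Lemma Lp_norm p D f : (1 <= p)%E -> mes D -> Lp p D f ->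
  Lp p D (fun x => `|f x|).
Proof.
move=> p1 mD Lf; apply: (Lp_mono p1 mD _ Lf).
  by apply: mfun_norm; exact: Lp_mfun Lf.
by apply: aeT => x Dx; rewrite normr_id.
Qed.

(** The form in which linear growth is used: [D] has finite measure, so that
    the constant [b] is in L^p. *)
Lemma Lp_dom p D f g a b : (1 <= p)%E -> mes D -> (mu D < +oo)%E ->
  mfun D g -> Lp p D f ->
  {ae mu, forall x, D x -> `|g x| <= a * `|f x| + b} -> Lp p D g.
Proof.
move=> p1 mD Doo mg Lf gf.
have L2 : Lp p D ((fun x => a * `|f x|) \+ cst b).
  by apply: LpD => //; [apply: LpZ => //; exact: Lp_norm|exact: Lp_cst].
apply: (Lp_mono p1 mD mg L2); apply: aeS gf => x gfx Dx; split => //.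
by rewrite (le_trans (gfx Dx))// ler_norm.
Qed.

Lemma Lp_bounded p D g M : (1 <= p)%E -> mes D -> (mu D < +oo)%E ->
  mfun D g -> (forall x, D x -> `|g x| <= M) -> Lp p D g.
Proof.
move=> p1 mD Doo mg gM.
apply: (@Lp_dom p D (cst 0) g 0 M) => //; first exact: Lp0.
by apply: aeT => x Dx; rewrite mul0r add0r gM.
Qed.

(** The restriction of [f] to the union is dominated by the sum of the absolute
    values of its restrictions to [D] and [E]. *)
Lemma LpU p D E f : (1 <= p)%E -> mes D -> mes E -> Lp p D f -> Lp p E f ->
  Lp p (D `|` E) f.
Proof.
move=> p1 mD mE Lf Lg.
have L2 : (fun x => `|(f \_ D) x|) \+ (fun x => `|(f \_ E) x|) \in Lfun mu p.
  have [_ LA] := Lfun_addr_closed mu p1.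
  apply: LA.
    apply: (Lfun_mono leb_gt0 p1 Lf); last by apply: aeT => x; rewrite normr_id.
    by apply: mfun_norm; apply: mfun_restr => //; exact: Lp_mfun Lf.
  apply: (Lfun_mono leb_gt0 p1 Lg); last by apply: aeT => x; rewrite normr_id.
  by apply: mfun_norm; apply: mfun_restr => //; exact: Lp_mfun Lg.
apply: (Lfun_mono leb_gt0 p1 L2).
  apply: mfun_restr; first exact: measurableU.
  apply/measurable_funU => //; split; first exact: Lp_mfun Lf.
  exact: Lp_mfun Lg.
apply: aeT => x /=; rewrite [leRHS]ger0_norm ?addr_ge0//.
rewrite {1}patchE; case: ifPn => [|_]; last by rewrite normr0 addr_ge0.
rewrite in_setU => /orP[xD|xE].
  by rewrite (patchE _ D) xD lerDl.
by rewrite (patchE _ E) xE lerDr.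
Qed.

Lemma Lp_aff p D f s c : (1 <= p)%E -> s = 1 \/ s = -1 -> mes D ->
  Lp p D f -> Lp p (aff s c @^-1` D) (f \o aff s c).
Proof.
move=> p1 hs mD /in_LfunE[mf nf].
have E : (f \o aff s c) \_ (aff s c @^-1` D) = (f \_ D) \o aff s c.
  by apply/funext => x; rewrite /= !patchE; case: ifPn.
apply/in_LfunE; rewrite E; split.
  have := mfun_aff (c := c) hs (@measurableT _ (lebT R)) mf.
  by rewrite preimage_setT.
case: p p1 nf => [r r1|_|//].
- move=> /(finite_norm_fin _ _ r1) fin; apply/(finite_norm_fin _ _ r1).
  have pos (x : R) : setT x -> (0 <= (`|(f \_ D) x| `^ r)%:E)%E.
    by rewrite lee_fin powR_ge0.
  have := leb_ge0_subst c hs (@measurableT _ (lebT R)) (powR_measurable r mf) pos.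
  by rewrite preimage_setT => ->.
- move=> /(finite_norm_oo leb_gt0)[M hM]; apply/(finite_norm_oo leb_gt0); exists M.
  exact: (ae_aff c hs hM).
Qed.

Lemma powR_restrict r D f : 1 <= r ->
  (fun x => (`|(f \_ D) x| `^ r)%:E) = (fun x => (`|f x| `^ r)%:E) \_ D.
Proof.
move=> r1; apply/funext => x; rewrite !patchE; case: ifP => // _.
by rewrite normr0 powR0// gt_eqF// (lt_le_trans ltr01).
Qed.

Lemma Lp_fin_int r D f : 1 <= r -> mes D -> Lp r%:E D f ->
  (\int[mu]_(x in D) (`|f x| `^ r)%:E < +oo)%E.
Proof.
move=> r1 mD /in_LfunE[_ /(finite_norm_fin _ _ r1)].
by rewrite powR_restrict// -integral_mkcond.
Qed.

Lemma int_Lp_fin r D f : 1 <= r -> mes D -> mfun D f ->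
  (\int[mu]_(x in D) (`|f x| `^ r)%:E < +oo)%E -> Lp r%:E D f.
Proof.
move=> r1 mD mf fi; apply/in_LfunE; split; first exact: mfun_restr.
by apply/(finite_norm_fin _ _ r1); rewrite powR_restrict// -integral_mkcond.
Qed.

Lemma Lp_oo_bound D f : Lp +oo%E D f ->
  exists M, {ae mu, forall x, D x -> `|f x| <= M}.
Proof.
move=> /in_LfunE[_ /(finite_norm_oo leb_gt0)[M hM]]; exists M.
by apply: aeS hM => x; rewrite patchE => + Dx; rewrite mem_set.
Qed.

Lemma Lp_oo_intro D f M : mes D -> mfun D f ->
  {ae mu, forall x, D x -> `|f x| <= M} -> Lp +oo%E D f.
Proof.
move=> mD mf fM; apply/in_LfunE; split; first exact: mfun_restr.
apply/(finite_norm_oo leb_gt0); exists `|M|; apply: aeS fM => x fM; rewrite patchE.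
case: ifPn => [|_]; last by rewrite normr0.
by rewrite inE => /fM /le_trans; apply; exact: ler_norm.
Qed.

(** For a finite exponent r >= 1, [`|f| <= `|f| `^ r + 1] and the constant 1 is
    integrable on a set of finite measure; for p = +oo, [f] is bounded a.e. *)
Lemma Lp_integrable p D f : (1 <= p)%E -> mes D -> (mu D < +oo)%E ->
  Lp p D f -> mu.-integrable D (EFin \o f).
Proof.
move=> p1 mD Doo Lf; have mf := Lp_mfun mD Lf.
have L1 : Lp 1%E D f.
  case: p p1 Lf => [r r1|_|//] Lf; last first.
    have [M hM] := Lp_oo_bound Lf.
    apply: (@Lp_dom _ D (cst 0) f 0 M) => //; first exact: Lp0.
    by apply: aeS hM => x hM Dx; rewrite mul0r add0r hM.
  apply: (@Lp_dom _ D (fun x => `|f x| `^ r) f 1 1) => //.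
    apply: (int_Lp_fin (lexx 1) mD).
      exact/measurable_EFinP/powR_measurable.
    rewrite (_ : (fun x => _) = (fun x => (`|f x| `^ r)%:E)).
      exact: Lp_fin_int.
    by apply/funext => x; rewrite powRr1// ger0_norm// powR_ge0.
  apply: aeT => x Dx; rewrite mul1r [X in _ <= X + _]ger0_norm ?powR_ge0//.
  have [f1|f1] := leP `|f x| 1.
    by apply: (le_trans f1); rewrite lerDr powR_ge0.
  apply: (@le_trans _ _ (`|f x| `^ r)); last by rewrite lerDl.
  by rewrite -[leLHS]powRr1// ler_powR// ltW.
move: L1; rewrite /Lp Lfun1_integrable => fi.
apply/(integrable_mkcond _ mD).
by rewrite restrict_EFin.
Qed.

End LebesgueSpaces.

(** * Integrals over intervals *)

Section AbstractIntegrals.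
Context d (T : measurableType d) (R : realType) (mu : {measure set T -> \bar R}).
Implicit Types (D E N : set T) (f : T -> R).
Local Notation intble D f := (mu.-integrable D (EFin \o f)).

Lemma integrable_setU D E f : measurable D -> measurable E ->
  intble D f -> intble E f -> intble (D `|` E) f.
Proof.
move=> mD mE /integrableP[mf fD] /integrableP[mf' fE].
have mDE : measurable (D `|` E) by exact: measurableU.
apply/integrableP; split; first by apply/measurable_funU.
have -> : D `|` E = D `|` (E `\` D) by rewrite setDE setUIr setUv setIT.
have mED : measurable (E `\` D) by exact: measurableD.
have mf2 : measurable_fun (E `\` D) (EFin \o f).
  by apply: measurable_funS mf' => //; exact: subDsetl.
rewrite ge0_integral_setU//; first last.
- by apply/disj_setPS => x [Dx [_ /(_ Dx)]].
- by apply/measurable_funU => //; split; apply: measurableT_comp.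
rewrite lte_add_pinfty//; apply: le_lt_trans fE.
apply: ge0_subset_integral => //.
exact: measurableT_comp.
Qed.

Lemma Rintegral_setU_disj D E f : measurable D -> measurable E ->
  [disjoint D & E] -> intble D f -> intble E f ->
  \int[mu]_(x in D `|` E) f x = \int[mu]_(x in D) f x + \int[mu]_(x in E) f x.
Proof.
by move=> mD mE DE fD fE; apply: Rintegral_setU => //; exact: integrable_setU.
Qed.

Hypothesis cmu : measure_is_complete mu.

Lemma null_subset_measurable D E : measurable D -> mu D = 0%E -> E `<=` D ->
  measurable E.
Proof. by move=> mD D0 ED; apply: cmu; exists D; split. Qed.

(** By completeness every function is measurable on a null set. *)
Lemma integrable_null N f : measurable N -> mu N = 0%E -> intble N f.
Proof.
move=> mN N0; apply: null_set_integrable => // _ Y mY.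
by apply: (null_subset_measurable mN N0); exact: subIsetl.
Qed.

Lemma Rintegral_null N f : measurable N -> mu N = 0%E ->
  \int[mu]_(x in N) f x = 0.
Proof.
move=> mN N0; rewrite /Rintegral null_set_integral//.
exact: measurable_int (integrable_null f mN N0).
Qed.

Lemma integrable_diff_null D E f : measurable D -> measurable E -> D `<=` E ->
  mu (E `\` D) = 0%E -> intble D f ->
  intble E f /\ \int[mu]_(x in E) f x = \int[mu]_(x in D) f x.
Proof.
move=> mD mE DE ED0 fD.
have mED : measurable (E `\` D) by exact: measurableD.
have fED := integrable_null f mED ED0.
have -> : E = D `|` (E `\` D).
  by rewrite setDE setUIr setUv setIT; apply/esym/setUidr.
split; first exact: integrable_setU.
rewrite Rintegral_setU_disj// ?(Rintegral_null _ mED)// ?addr0//.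
by apply/disj_setPS => x [Dx [_ /(_ Dx)]].
Qed.

End AbstractIntegrals.

Section IntegralsOnIntervals.
Context {R : realType}.
Implicit Types (A B D E N : set R) (f g h F : R -> R) (a b c : R).
Local Notation mu := (leb R).
Local Notation mes D := (@measurable _ (lebT R) D).
Local Notation mfun D f := (@measurable_fun _ _ (lebT R) R D f).
Local Notation intble D f := (mu.-integrable D (EFin \o f)).

(** A nonempty open interval is not a null set. *)
Lemma ae_exists a b (P : R -> Prop) : a < b ->
  {ae mu, forall x, P x} -> exists x, a < x < b /\ P x.
Proof.
move=> ab [N [mN N0 PN]]; apply: contrapT => nex.
have : (mu `]a, b[%classic <= mu N)%E.
  apply: le_measure; rewrite ?inE//; first exact: leb_itv_mes.
  move=> x /=; rewrite in_itv/= => xab; apply: PN => /= Px.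
  by apply: nex; exists x.
by rewrite N0 (leb_oo (ltW ab)) lee_fin leNgt subr_gt0 ab.
Qed.

Lemma null_all_mes A B : mes A -> mu A = 0%E -> B `<=` A -> mes B.
Proof. exact: (null_subset_measurable (@completed_lebesgue_measure_is_complete R)). Qed.

Lemma intble_sub D E f : mes D -> mes E -> E `<=` D -> intble D f -> intble E f.
Proof. by move=> mD mE ED; exact: integrableS. Qed.

Let cleb := @completed_lebesgue_measure_is_complete R.

Lemma intbleU D E f : mes D -> mes E -> intble D f -> intble E f ->
  intble (D `|` E) f.
Proof. exact: integrable_setU. Qed.

Lemma Rint_setU D E f : mes D -> mes E -> [disjoint D & E] ->
  intble D f -> intble E f ->
  \int[mu]_(x in D `|` E) f x = \int[mu]_(x in D) f x + \int[mu]_(x in E) f x.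
Proof. exact: Rintegral_setU_disj. Qed.

Lemma intble_diff_null D E f : mes D -> mes E -> D `<=` E ->
  mu (E `\` D) = 0%E -> intble D f ->
  intble E f /\ \int[mu]_(x in E) f x = \int[mu]_(x in D) f x.
Proof. exact: (integrable_diff_null cleb). Qed.

Lemma itv_cc_diff a b : mu (`[a, b]%classic `\` `]a, b[%classic) = 0%E.
Proof.
have s1 x : mu [set x] = 0%E by exact: (lebesgue_measure_set1 x).
have m1 x : mes [set x] by apply: borel_leb; exact: measurable_set1.
apply/eqP; rewrite eq_le measure_ge0 andbT.
apply: (@le_trans _ _ (mu ([set a] `|` [set b]))).
  apply: le_measure; rewrite ?inE//.
  - by apply: measurableD; exact: leb_itv_mes.
  - exact: measurableU.
  - move=> x [] /=; rewrite !in_itv/= => /andP[ax xb] /negP.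
    rewrite negb_and -!leNgt => /orP[xa|bx]; [left|right]; apply/eqP.
      by rewrite eq_le xa ax.
    by rewrite eq_le bx xb.
apply: (le_trans (measureU2 mu (m1 a) (m1 b))).
by rewrite [X in (X + _)%E](s1 a) [X in (_ + X)%E](s1 b) adde0.
Qed.

Lemma Rint_cc a b f : intble `]a, b[%classic f ->
  \int[mu]_(x in `[a, b]) f x = \int[mu]_(x in `]a, b[) f x.
Proof.
move=> fi; apply: (intble_diff_null _ _ _ (itv_cc_diff a b) fi).2.
- exact: leb_itv_mes.
- exact: leb_itv_mes.
- exact: subset_itv_oo_cc.
Qed.

Lemma intble_itv_sub a b c d f : a <= c -> d <= b ->
  intble `]a, b[%classic f -> intble `]c, d[%classic f.
Proof.
move=> ac db; apply: intble_sub; [exact: leb_itv_mes|exact: leb_itv_mes|].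
move=> x /=; rewrite !in_itv/= => /andP[cx xd].
by rewrite (le_lt_trans ac cx) (lt_le_trans xd db).
Qed.

Lemma Rint_chasles a b c f : a <= b -> b <= c -> intble `]a, c[%classic f ->
  \int[mu]_(x in `]a, c[) f x =
  \int[mu]_(x in `]a, b[) f x + \int[mu]_(x in `]b, c[) f x.
Proof.
move=> ab bc fi.
have fi1 : intble `]a, b[%classic f by exact: intble_itv_sub fi.
have fi2 : intble `]b, c[%classic f by exact: intble_itv_sub fi.
rewrite -Rint_setU//; [|exact: leb_itv_mes|exact: leb_itv_mes|]; last first.
  apply/disj_setPS => x [] /=; rewrite !in_itv/= => /andP[_ xb] /andP[bx _].
  by have := lt_trans xb bx; rewrite ltxx.
have mU : mes (`]a, b[%classic `|` `]b, c[%classic).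
  by apply: measurableU; exact: leb_itv_mes.
have m1 : mes [set b] by apply: borel_leb; exact: measurable_set1.
have m0 : mes `]a, c[%classic by exact: leb_itv_mes.
apply: (intble_diff_null mU m0 _ _ _).2.
- move=> x [] /=; rewrite !in_itv/= => /andP[u v].
    by rewrite u (lt_le_trans v bc).
  by rewrite v (le_lt_trans ab u).
- apply/eqP; rewrite eq_le measure_ge0 andbT.
  rewrite -[leRHS](lebesgue_measure_set1 b).
  apply: (@le_measure _ _ _ mu); rewrite ?inE//; first exact: measurableD.
  move=> x [] /=; rewrite !in_itv/= => /andP[ax xc] /not_orP[/negP + /negP].
  rewrite ax xc/= andbT -!leNgt => bx xb.
  by apply/eqP; rewrite eq_le bx xb.
- by apply: intbleU => //; exact: leb_itv_mes.
Qed.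

(** Absolute continuity of the integral, applied to [f \_ D]. *)
Lemma integral_small D f (e : R) : mes D -> intble D f -> 0 < e ->
  exists2 d : R, 0 < d & forall E, mes E -> E `<=` D ->
    (mu E < d%:E)%E -> `|\int[mu]_(x in E) f x| < e.
Proof.
move=> mD fi e0.
have fi' : mu.-integrable setT (EFin \o (f \_ D)).
  by rewrite -restrict_EFin; exact/(integrable_mkcond _ mD).
have [d [d0 dP]] := integral_normr_continuous fi' e0.
exists d => // E mE ED Ed; apply: le_lt_trans (dP E mE Ed).
rewrite (@eq_Rintegral _ _ _ mu _ (f \_ D) f); last first.
  by move=> x /set_mem /ED Dx; rewrite patchE mem_set.
apply: le_normr_Rintegral => //.
exact: (@integrableS _ _ _ mu setT E).
Qed.

End IntegralsOnIntervals.

(** * Functions whose primitives vanish *)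

Section VanishingIntegrals.
Context {R : realType}.
Implicit Types (A B D E N : set R) (f g h F : R -> R) (a b c T : R).
Local Notation mu := (leb R).
Local Notation mes D := (@measurable _ (lebT R) D).
Local Notation intble D f := (mu.-integrable D (EFin \o f)).

(** The primitive is continuous, by absolute continuity of the integral, and
    vanishes on a dense set. *)
Lemma vanishing_everywhere T F : intble `]0, T[%classic F ->
  {ae mu, forall x, 0 < x < T -> \int[mu]_(y in `]0, x[) F y = 0} ->
  forall x, 0 < x <= T -> \int[mu]_(y in `]0, x[) F y = 0.
Proof.
move=> Fi hF x /andP[x0 xT].
have mI (i : interval R) : mes [set` i] by exact: leb_itv_mes.
apply/eqP; rewrite -normr_le0; apply/ler_addgt0Pr => e e0; rewrite add0r.
have [d d0 dP] := integral_small (mI _) Fi e0.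
have : Num.max 0 (x - d) < x by rewrite gt_max x0 gtrBl d0.
move=> /ae_exists -/(_ _ hF)[y [/andP[]]].
rewrite gt_max => /andP[y0 xdy] yx Fy.
have {}Fy : \int[mu]_(y in `]0, y[) F y = 0.
  by apply: Fy; rewrite y0 (lt_le_trans yx).
rewrite (Rint_chasles (ltW y0) (ltW yx)); last first.
  by apply: intble_itv_sub Fi.
rewrite Fy add0r ltW//; apply: dP; first exact: mI.
- move=> z /=; rewrite !in_itv/= => /andP[yz zx].
  by rewrite (lt_trans y0 yz) (lt_le_trans zx xT).
- by rewrite leb_oo ?ltW// lte_fin ltrBlDr -ltrBlDl.
Qed.

(** The sets [S] such that [F] has integral 0 over the part of [S] in ]0, T[
    form a Dynkin system. It contains the rays ]-oo, x[, hence all Borel sets,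
    and then all Lebesgue measurable sets up to null sets; a function whose
    integral over every measurable set is 0 vanishes a.e. *)
Lemma vanishing_ae T F : intble `]0, T[%classic F ->
  {ae mu, forall x, 0 < x < T -> \int[mu]_(y in `]0, x[) F y = 0} ->
  {ae mu, forall x, 0 < x < T -> F x = 0}.
Proof.
have [T0|T0] := leP T 0.
  move=> _ _; apply: aeT => x /andP[x0 xT].
  by have := lt_le_trans (lt_trans x0 xT) T0; rewrite ltxx.
move=> Fi /(vanishing_everywhere Fi) hF.
have mI (i : interval R) : mes [set` i] by exact: leb_itv_mes.
set D := `]0, T[%classic in Fi *.
have mD : mes D by exact: mI.
have fin E : mes E -> E `<=` D -> intble E F.
  by move=> mE ED; exact: intble_sub Fi.
have finD E : mes E -> intble (E `&` D) F.
  by move=> mE; apply: fin; [exact: measurableI|exact: subIsetr].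
have FE x : 0 < x <= T -> (\int[mu]_(y in `]0%R, x[) (F y)%:E = 0)%E.
  move=> hx; have /andP[x0 xT] := hx.
  have /integrable_fin_num fn : intble `]0, x[%classic F.
    by exact: intble_itv_sub Fi.
  by rewrite -(fineK (fn (mI _))); congr EFin; exact: hF.
have FD : (\int[mu]_(y in D) (F y)%:E = 0)%E by rewrite FE// T0 lexx.
have borel0 (S : set R) : @measurable _ (measurableTypeR R) S ->
    (\int[mu]_(y in S `&` D) (F y)%:E = 0)%E.
  move=> mS.
  have gS : <<s @RGenInftyO.G R >> S.
    by have <- : @measurable _ (measurableTypeR R) = <<s @RGenInftyO.G R >>
      := RGenInftyO.measurableE R.
  apply: (@dynkin_induction _ (measurableTypeR R) (@RGenInftyO.G R)
    (fun S : set R => \int[mu]_(y in S `&` D) (F y)%:E = 0)%E _ _ _ _ _ _ S gS).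
  - exact: RGenInftyO.measurableE.
  - move=> _ _ [x ->] [y ->]; exists (Num.min x y).
    by apply/seteqP; split => z /=; rewrite !in_itv/= lt_min;
      [move=> [-> ->]|move=> /andP[]].
  - by rewrite setTI.
  - move=> _ [x ->] /=.
    have [x0|x0] := leP x 0.
      rewrite (_ : _ `&` _ = set0) ?integral_set0//.
      apply/seteqP; split => z //= [] /=; rewrite /D /= !in_itv/= => zx /andP[z0 _].
      by have := lt_trans (lt_le_trans zx x0) z0; rewrite ltxx.
    rewrite (_ : _ `&` _ = `]0, Num.min x T[%classic).
      by apply: FE; rewrite lt_min x0 T0/= ge_min lexx orbT.
    apply/seteqP; split => z /=; rewrite /D /= !in_itv/= lt_min.
      by move=> [-> /andP[-> ->]].
    by move=> /and3P[-> -> ->].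
  - move=> B mB B0; have mB' : mes B by exact: borel_leb.
    have DE : (B `&` D) `|` (~` B `&` D) = D by rewrite -setIUl setUv setTI.
    have := FD; rewrite -[X in integral _ X _]DE integral_setU.
    + by rewrite B0 add0e.
    + exact: measurableI.
    + by apply: measurableI => //; exact: measurableC.
    + by rewrite DE; exact: measurable_int Fi.
    + by apply/disj_setPS => z [[Bz _] [/(_ Bz)]].
  - move=> B mB tB B0; rewrite setI_bigcupl integral_bigcup.
    + by rewrite eseries0// => i _ _.
    + exact: trivIset_setIr.
    + by move=> k; apply: measurableI => //; exact: borel_leb.
    + rewrite -setI_bigcupl; apply: finD.
      by apply: bigcupT_measurable => k; exact: borel_leb.
have : ae_eq mu D (EFin \o F) (cst 0%E).
  apply: integral_ae_eq => // E ED mE; rewrite integral0.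
  have [A [N [mA nN _ EAN]]] := leb_decomp mE.
  have mN : mes N by exact: leb_null_mes.
  have N0 : mu N = 0%E by exact: (negligibleP _ mN).1.
  have mA' : mes A by exact: borel_leb.
  have AD : A `&` D = A by apply/setIidPl; apply: subset_trans ED; rewrite EAN; exact: subsetUl.
  have := borel0 _ mA; rewrite AD => A0.
  have AiD : A `<=` D by rewrite -AD; exact: subIsetr.
  rewrite (negligible_integral mN mE (fin _ mE ED) N0).
  have := negligible_integral mN mA' (fin _ mA' AiD) N0; rewrite [LHS]A0 => ->.
  by rewrite EAN setDUl setDv setU0.
by apply: aeS => x /= + xT; rewrite /D /= in_itv/= => /(_ xT) [].
Qed.

End VanishingIntegrals.

(** * Test functions close to the indicator of an interval *)

(** Carries the fundamental theorem of calculus from Borel functions to [leb]. *)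
Lemma integral_leb_lebesgue (R : realType) (D : set R) (h : R -> \bar R) :
  @measurable _ (measurableTypeR R) D ->
  @measurable_fun _ _ (measurableTypeR R) _ D h -> (forall x, D x -> (0 <= h x)%E) ->
  (\int[leb R]_(x in D) h x = \int[@lebesgue_measure R]_(x in D) h x)%E.
Proof.
move=> mD mh h0.
have mid : @measurable_fun _ _ (lebT R) (measurableTypeR R) setT idfun.
  by move=> _ Y mY; rewrite setTI preimage_id; exact: borel_leb.
have := @ge0_integral_pushforward _ _ (lebT R) (measurableTypeR R) R idfun mid
  (leb R) D h mD mh.
rewrite preimage_id => <-; last by move=> x /set_mem; exact: h0.
by apply: eq_measure_integral => //=.
Qed.

(** For piecewise quadratic functions such a bound needs no separate treatment
    of the points where two pieces meet. *)
Lemma quadratic_is_derive (R : realType) (F : R -> R) (x dF C : R) :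
  (forall h, `|F (x + h) - F x - dF * h| <= C * h ^+ 2) -> is_derive x 1 F dF.
Proof.
move=> hF.
have lim : (fun h => h^-1 *: ((F \o shift x) (h *: 1) - F x)) @ 0^' --> dF.
  apply/cvgrPdist_le => e e0; near=> h.
  have h0 : h != 0 by near: h; exact: nbhs_dnbhs_neq.
  rewrite /= /shift -[h *: 1]/(h * 1) mulr1 [h + x]addrC -[_ *: _]/(_ * _).
  rewrite (_ : _ - _ = - (h^-1 * (F (x + h) - F x - dF * h))); last by field.
  rewrite normrN normrM normfV ler_pdivrMl ?normr_gt0//.
  apply: (le_trans (hF h)).
  have C1 : 0 < `|C| + 1 by rewrite ltr_wpDl.
  have he : `|h| < e / (`|C| + 1).
    by near: h; apply: dnbhs0_lt; rewrite divr_gt0.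
  rewrite ltr_pdivlMr// in he.
  rewrite -real_normK ?num_real// expr2 mulrCA ler_pM2l ?normr_gt0//.
  apply: le_trans (ltW he); rewrite mulrC ler_wpM2l//.
  by rewrite (le_trans (ler_norm C))// lerDl.
by split; [apply/cvg_ex; exists dF|exact: cvg_lim lim].
Unshelve. all: by end_near. Qed.

Section TestFunctions.
Context {R : realType}.
Implicit Types (x y c a b : R).

(** The positive part of [y]. *)
Definition ppart y : R := (y + `|y|) / 2.
(** The hat function with support [0, 2] and, below, its primitive, a C^1 step
    from 0 to 1. Both are second differences of powers of [ppart], so that their
    properties follow from those of [ppart y ^+ 2]. *)
Definition tent y : R := ppart y - 2 * ppart (y - 1) + ppart (y - 2).
Definition smoothstep y : R :=
  (ppart y ^+ 2 - 2 * ppart (y - 1) ^+ 2 + ppart (y - 2) ^+ 2) / 2.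

Lemma ppart_ge y : 0 <= y -> ppart y = y.
Proof. by move=> y0; rewrite /ppart ger0_norm//; lra. Qed.

Lemma ppart_le y : y <= 0 -> ppart y = 0.
Proof. by move=> y0; rewrite /ppart ler0_norm//; lra. Qed.

Lemma tent_bounds y : 0 <= tent y <= 1.
Proof.
rewrite /tent; have [y0|y0] := leP y 0.
  rewrite !ppart_le; lra.
rewrite (ppart_ge (ltW y0)); have [y1|y1] := leP y 1.
  rewrite !ppart_le; lra.
rewrite (@ppart_ge (y - 1)); last by lra.
have [y2|y2] := leP y 2; first by rewrite ppart_le; lra.
by rewrite ppart_ge; lra.
Qed.

Lemma tent_out y : y <= 0 \/ 2 <= y -> tent y = 0.
Proof.
rewrite /tent => -[y0|y2]; first by rewrite !ppart_le; lra.
by rewrite !ppart_ge; lra.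
Qed.

Lemma smoothstep0 y : y <= 0 -> smoothstep y = 0.
Proof. by move=> y0; rewrite /smoothstep !ppart_le; lra. Qed.

Lemma smoothstep1 y : 2 <= y -> smoothstep y = 1.
Proof. by move=> y0; rewrite /smoothstep !ppart_ge; [field|lra..]. Qed.

Lemma smoothstep_bounds y : 0 <= smoothstep y <= 1.
Proof.
have [y0|y0] := leP y 0; first by rewrite smoothstep0//; lra.
have [y2|y2] := leP 2 y; first by rewrite smoothstep1//; lra.
rewrite /smoothstep (ppart_ge (ltW y0)); have [y1|y1] := leP y 1.
  by rewrite !ppart_le; nra.
by rewrite (@ppart_ge (y - 1)) ?(@ppart_le (y - 2)); nra.
Qed.

Lemma ppart_sq_quadratic y h :
  `|ppart (y + h) ^+ 2 - ppart y ^+ 2 - 2 * ppart y * h| <= h ^+ 2.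
Proof.
have [y0|y0] := leP 0 y; have [z0|z0] := leP 0 (y + h).
- by rewrite !ppart_ge// (_ : _ - _ = h ^+ 2) ?ger0_norm ?sqr_ge0//; ring.
- rewrite (ppart_ge y0) (ppart_le (ltW z0)) ler_norml; apply/andP; split; nra.
- rewrite (ppart_le (ltW y0)) (ppart_ge z0) ler_norml; apply/andP; split; nra.
- rewrite (ppart_le (ltW y0)) (ppart_le (ltW z0)) expr0n/= mulr0 mul0r !subr0.
  by rewrite normr0 sqr_ge0.
Qed.

Lemma smoothstep_quadratic y h :
  `|smoothstep (y + h) - smoothstep y - tent y * h| <= 2 * h ^+ 2.
Proof.
have := ppart_sq_quadratic y h.
have := ppart_sq_quadratic (y - 1) h.
have := ppart_sq_quadratic (y - 2) h.
rewrite /smoothstep /tent (_ : y - 2 + h = y + h - 2); last by ring.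
rewrite (_ : y - 1 + h = y + h - 1); last by ring.
rewrite !ler_norml => /andP[A1 A2] /andP[B1 B2] /andP[C1 C2].
by apply/andP; split; lra.
Qed.

Lemma ppart_continuous : continuous ppart.
Proof.
move=> y; rewrite /ppart; apply: cvgMl; apply: cvgD; first exact: cvg_id.
exact: norm_continuous.
Qed.

End TestFunctions.

(** * A weak derivative integrates back to the function *)

Lemma integrable_restriction d (T : measurableType d) (R : realType)
    (mu : {measure set T -> \bar R}) (D E : set T) (f : T -> R) :
  measurable D -> measurable E -> mu.-integrable D (EFin \o f) ->
  mu.-integrable D (EFin \o (f \_ E)).
Proof.
move=> mD mE fi; apply: (le_integrable mD _ _ fi).
  apply/measurable_EFinP/(measurable_restrict f mE mD).
  apply: (@measurable_funS _ _ _ _ D) => //.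
  exact/measurable_EFinP/(measurable_int mu).
by move=> x _; rewrite /= lee_fin patchE; case: ifP; rewrite ?normr0.
Qed.

Section WeakDerivatives.
Context {R : realType}.
Implicit Types (u h : R -> R) (c a b v e : R).
Local Notation mu := (leb R).
Local Notation mes D := (@measurable _ (lebT R) D).
Local Notation mfun D f := (@measurable_fun _ _ (lebT R) R D f).
Local Notation intble D f := (mu.-integrable D (EFin \o f)).
Let D : set R := `]0, 1[%classic.
Let mD : mes D. Proof. exact: leb_itv_mes. Qed.

(** [ramp c a] climbs from 0 to 1 on the interval from [a / c] to [(a + 2) / c],
    and [bump c a] is its derivative. *)
Definition ramp c a (x : R) : R := smoothstep (c * x - a).
Definition bump c a (x : R) : R := c * tent (c * x - a).

Lemma ramp_is_derive c a (x : R) : is_derive x 1 (ramp c a) (bump c a x).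
Proof.
apply: (@quadratic_is_derive _ _ _ _ (2 * c ^+ 2)) => h.
have := smoothstep_quadratic (c * x - a) (c * h).
rewrite /ramp /bump (_ : c * x - a + c * h = c * (x + h) - a); last by ring.
rewrite (_ : tent _ * (c * h) = c * tent (c * x - a) * h); last by ring.
by move=> /le_trans; apply; rewrite exprMn mulrA.
Qed.

Lemma bump_continuous c a : continuous (bump c a).
Proof.
have aff z : continuous (fun x : R => c * x - a - z).
  move=> x; apply: cvgB; last exact: cvg_cst.
  by apply: cvgB; [apply: cvgMr; exact: cvg_id|exact: cvg_cst].
have pc z : continuous (fun x : R => ppart (c * x - a - z)).
  by move=> x; apply: (continuous_comp (aff z x)); exact: ppart_continuous.
have p0 : continuous (fun x : R => ppart (c * x - a)).
  by move=> x; have := pc 0 x; under eq_fun do rewrite subr0.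
move=> x; rewrite /bump /tent; apply: cvgMr.
apply: cvgD; last exact: pc.
by apply: cvgB; [exact: p0|apply: cvgMr; exact: pc].
Qed.

Lemma ramp_continuous c a : continuous (ramp c a).
Proof.
move=> x; have [dr _] := ramp_is_derive c a x.
by apply: differentiable_continuous; exact/derivable1_diffP.
Qed.

Lemma bump_ge0 c a (x : R) : 0 <= c -> 0 <= bump c a x.
Proof. by move=> c0; rewrite mulr_ge0//; case/andP: (tent_bounds (c * x - a)). Qed.

Lemma bump_borel c a E : @measurable_fun _ _ (measurableTypeR R) R E (bump c a).
Proof.
by apply: measurable_funTS; apply: continuous_measurable_fun; exact: bump_continuous.
Qed.

Lemma bump_mfun c a : mfun D (bump c a).
Proof. by apply: borel_mfun; [exact: measurable_itv|exact: bump_borel]. Qed.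

Lemma bump_le c a (x : R) : 0 <= c -> bump c a x <= c.
Proof. by move=> c0; rewrite ler_piMr//; case/andP: (tent_bounds (c * x - a)). Qed.

Lemma muD_lty : (mu D < +oo)%E.
Proof. by rewrite leb_oo// ltry. Qed.

Lemma intble_bounded_mul M f h : mfun D h -> (forall x, D x -> `|h x| <= M) ->
  intble D f -> intble D (fun x => f x * h x).
Proof.
move=> mh hM fi; have mf : mfun D f by exact/measurable_EFinP/(measurable_int mu).
have fM : intble D (fun x => M * f x).
  have := integrableZl mD M fi; exact.
apply: (le_integrable mD _ _ fM).
  by apply/measurable_EFinP; exact: measurable_funM.
move=> x Dx; rewrite /= lee_fin !normrM mulrC ler_wpM2r//.
by rewrite (le_trans (hM x Dx))// ler_norm.
Qed.

Lemma bump_intble c a : 0 <= c -> intble D (bump c a).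
Proof.
move=> c0; apply: (Lp_integrable (lexx 1%E) mD muD_lty).
apply: (Lp_bounded (M := c) (lexx 1%E) mD muD_lty); first exact: bump_mfun.
by move=> x _; rewrite ger0_norm ?bump_ge0// bump_le.
Qed.

Lemma bump_total c a : 0 < c -> 0 <= a -> a + 2 <= c ->
  \int[mu]_(x in D) bump c a x = 1.
Proof.
move=> c0 a0 ac.
rewrite -Rint_cc; last exact/bump_intble/ltW.
have pos (x : R) : `[0%R, 1%R]%classic x -> (0 <= (bump c a x)%:E)%E.
  by move=> _; rewrite lee_fin bump_ge0// ltW.
have mb : @measurable_fun _ _ (measurableTypeR R) _ `[0%R, 1%R]%classic
    (fun x => (bump c a x)%:E).
  apply/(@measurable_EFinP _ (measurableTypeR R)); exact: bump_borel.
rewrite /Rintegral (integral_leb_lebesgue (measurable_itv _) mb pos).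
rewrite (@continuous_FTC2 _ _ (ramp c a))//.
- rewrite /ramp mulr0 sub0r mulr1 smoothstep1; last by lra.
  by rewrite smoothstep0 ?sube0//; lra.
- by apply: continuous_subspaceT; exact: bump_continuous.
- split.
  + by move=> x _; have [] := ramp_is_derive c a x.
  + by apply: cvg_at_right_filter; exact: ramp_continuous.
  + by apply: cvg_at_left_filter; exact: ramp_continuous.
- by move=> x _; rewrite derive1E; case: (ramp_is_derive c a x).
Qed.

(** A bump is nonnegative and has integral one, so integration against it
    averages [u] over the support of the bump. *)
Lemma bump_average u v e c a : 0 < c -> 0 <= a -> a + 2 <= c -> intble D u ->
  (forall x, D x -> a < c * x < a + 2 -> `|u x - v| <= e) ->
  `|\int[mu]_(x in D) (u x * bump c a x) - v| <= e.
Proof.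
move=> c0 a0 ac ui hu.
have bi := bump_intble a (ltW c0).
have bb x : D x -> `|bump c a x| <= c.
  by move=> _; rewrite ger0_norm ?bump_ge0 ?bump_le// ltW.
have ubi := intble_bounded_mul (bump_mfun c a) bb ui.
have vbi : intble D (fun x => v * bump c a x) by have := integrableZl mD v bi; exact.
have ebi : intble D (fun x => e * bump c a x) by have := integrableZl mD e bi; exact.
have di : intble D (fun x => u x * bump c a x - v * bump c a x).
  by have := integrableB mD ubi vbi; exact.
have ni : intble D (fun x => `|u x * bump c a x - v * bump c a x|).
  by have := integrable_norm di; exact.
have E : \int[mu]_(x in D) (u x * bump c a x) - v =
    \int[mu]_(x in D) (u x * bump c a x - v * bump c a x).
  by rewrite (RintegralB mD ubi vbi) (RintegralZl v mD bi) bump_total// mulr1.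
rewrite E; apply: (le_trans (le_normr_Rintegral mD di)).
have -> : e = \int[mu]_(x in D) (e * bump c a x).
  by rewrite (RintegralZl e mD bi) bump_total// mulr1.
apply: (le_Rintegral mD ni ebi) => x Dx.
rewrite -mulrBl normrM (ger0_norm (bump_ge0 _ _ (ltW c0))).
have [ax|nax] := boolP (a < c * x < a + 2).
  by rewrite (ler_wpM2r (bump_ge0 _ _ (ltW c0)))// hu.
rewrite /bump tent_out ?mulr0//.
by move: nax; rewrite negb_and -!leNgt => /orP[|];
  [left; rewrite subr_le0|right; rewrite lerBrDl].
Qed.

(** As [c] grows this approximates the indicator function of ]0, b[, while its
    derivative is a bump near 0 minus a bump near [b]: testing a weak derivative
    against it compares [u b] with [u 0]. *)
Definition plateau c b (x : R) : R := ramp c 1 x - ramp c (c * b) x.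

Lemma plateau_is_derive c b (x : R) :
  is_derive x 1 (plateau c b) (bump c 1 x - bump c (c * b) x).
Proof.
have := ramp_is_derive c 1 x; have := ramp_is_derive c (c * b) x.
move=> d1 d2; exact: is_deriveB.
Qed.

Lemma derive1_plateau c b :
  derive1 (plateau c b) = fun x => bump c 1 x - bump c (c * b) x.
Proof.
by apply/funext => x; rewrite derive1E; case: (plateau_is_derive c b x).
Qed.

(** The support starts at [1 / c] and ends at [b + 2 / c]. *)
Lemma plateau_test c b : 0 < c -> 1 <= c * b -> c * b + 2 < c ->
  test_function (plateau c b).
Proof.
move=> c0 cb1 cbc; split.
- by move=> x; case: (plateau_is_derive c b x).
- rewrite derive1_plateau => x.
  by apply: cvgB; exact: bump_continuous.
- exists `[c^-1, b + 2 / c]%classic; split; first exact: segment_compact.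
  + move=> x /=; rewrite !in_itv/= => /andP[cx xb].
    rewrite (lt_le_trans _ cx) ?invr_gt0//= (le_lt_trans xb)//.
    by rewrite -(ltr_pM2l c0) mulrDr mulr1 mulrCA (mulfV (lt0r_neq0 c0)) mulr1.
  + move=> x /= /negP; rewrite in_itv/= negb_and -!ltNge => /orP[xc|xb].
      have cx1 : c * x < 1 by rewrite -(mulfV (lt0r_neq0 c0)) ltr_pM2l.
      by rewrite /plateau /ramp !smoothstep0 ?subrr//; lra.
    have cx2 : c * b + 2 < c * x.
      by rewrite -(ltr_pM2l c0) mulrDr mulrCA (mulfV (lt0r_neq0 c0)) mulr1 in xb.
    by rewrite /plateau /ramp !smoothstep1 ?subrr//; lra.
Qed.

Lemma plateau_le1 c b (x : R) : `|plateau c b x| <= 1.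
Proof.
have := smoothstep_bounds (c * x - 1).
have := smoothstep_bounds (c * x - c * b).
rewrite /plateau /ramp => /andP[? ?] /andP[? ?].
by rewrite ler_norml; apply/andP; split; lra.
Qed.

(** The plateau differs from the indicator function of ]0, b[ only on its two
    slopes and to the left of the first one, on a set of total length [5 / c]. *)
Lemma plateau_close c b (x : R) : 0 < c -> 0 < x ->
  (x <= 3 / c \/ b <= x <= b + 2 / c ->
     `|plateau c b x - (if x < b then 1 else 0)| <= 1) /\
  (~ (x <= 3 / c \/ b <= x <= b + 2 / c) ->
     plateau c b x = if x < b then 1 else 0).
Proof.
move=> c0 x0; have /andP[r0 r1] := smoothstep_bounds (c * x - 1).
have /andP[s0 s1] := smoothstep_bounds (c * x - c * b).
rewrite /plateau /ramp; split.
  move=> _; case: ltP => xb.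
    have cxb : c * x < c * b by rewrite ltr_pM2l.
    rewrite (@smoothstep0 _ (c * x - c * b)); last by lra.
    by rewrite ler_norml; apply/andP; split; lra.
  by rewrite ler_norml; apply/andP; split; lra.
move=> /not_orP[/negP + /negP]; rewrite -ltNge ltr_pdivrMr// => x3.
have -> : smoothstep (c * x - 1) = 1 by rewrite smoothstep1//; lra.
case: ltP => [xb _|bx].
  have cxb : c * x < c * b by rewrite ltr_pM2l.
  by rewrite smoothstep0 ?subr0//; lra.
rewrite /= -ltNge => xb.
have cx2 : c * b + 2 < c * x.
  by rewrite -(ltr_pM2l c0) mulrDr mulrCA (mulfV (lt0r_neq0 c0)) mulr1 in xb.
by rewrite smoothstep1 ?subrr//; lra.
Qed.

Lemma within_segment_close u (x e : R) : {within `[0, 1], continuous u} ->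
  0 <= x <= 1 -> 0 < e ->
  exists2 d, 0 < d & forall y, 0 <= y <= 1 -> `|x - y| < d -> `|u x - u y| <= e.
Proof.
move=> /subspace_continuousP cu x01 e0.
have Ax : `[0, 1]%classic x by rewrite /= in_itv.
have := cu x Ax; move=> /cvgrPdist_le /(_ e e0).
rewrite near_withinE => /nbhs_ballP[d /= d0 hd]; exists d => // y y01 xy.
by apply: hd => //=; rewrite in_itv.
Qed.

(** The error is at most the integral of [`|h|] over the set where the plateau
    differs from the indicator function, which has measure at most [5 / c]. *)
Lemma plateau_cvg h b e : 0 < b < 1 -> intble D h -> 0 < e ->
  exists2 c1, 0 < c1 & forall c, c1 <= c -> c * b + 2 < c ->
    `|\int[mu]_(x in D) (h x * plateau c b x) - \int[mu]_(x in `]0, b[) h x| <= e.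
Proof.
move=> /andP[b0 b1] hi e0.
have ni : intble D (fun x => `|h x|) by have := integrable_norm hi; exact.
have [d d0 dP] := integral_small mD ni e0.
(* With [c >= 6 / d] the exceptional set has measure at most 5 / c < d. *)
exists (6 / d); first by rewrite divr_gt0.
move=> c c1c cbc.
have c0 : 0 < c by apply: lt_le_trans c1c; rewrite divr_gt0.
set E : set R := D `&` (`[0, 3 / c] `|` `[b, b + 2 / c])%classic.
have mI (i : interval R) : mes [set` i] by exact: leb_itv_mes.
have mE : mes E.
  by apply: measurableI; [exact: mD|apply: measurableU; exact: mI].
have muE : (mu E < d%:E)%E.
  have m2 : mes (`[0, 3 / c] `|` `[b, b + 2 / c])%classic.
    by apply: measurableU; exact: mI.
  apply: (@le_lt_trans _ _ (mu (`[0, 3 / c] `|` `[b, b + 2 / c])%classic)).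
    by apply: le_measure; rewrite ?inE; [exact: mE|exact: m2|exact: subIsetr].
  apply: (le_lt_trans (measureU2 mu (mI _) (mI _))).
  rewrite [X in (X + _)%E](leb_itvE `[0, 3 / c]) [X in (_ + X)%E](leb_itvE `[b, b + 2 / c]).
  rewrite /= !lte_fin ltrDl !divr_gt0// -!EFinB -EFinD lte_fin subr0.
  rewrite addrAC subrr add0r -mulrDl ltr_pdivrMr//.
  move: c1c; rewrite ler_pdivrMr// [d * c]mulrC => c1c.
  by lra.
have mp : mfun D (plateau c b).
  apply: borel_mfun; first exact: measurable_itv.
  apply: measurable_funTS; apply: continuous_measurable_fun => x.
  by apply: cvgB; exact: ramp_continuous.
have pb x : D x -> `|plateau c b x| <= 1 by move=> _; exact: plateau_le1.
have hpi := intble_bounded_mul mp pb hi.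
have mb : mes `]0, b[%classic by exact: mI.
have bD : `]0, b[%classic `<=` D.
  by move=> x; rewrite /D /= !in_itv/= => /andP[-> xb]; rewrite (lt_trans xb b1).
have hb : \int[mu]_(x in `]0, b[) h x = \int[mu]_(x in D) (h \_ `]0, b[) x.
  by rewrite -Rintegral_mkcondr setIidr.
have hbi : intble D (h \_ `]0, b[) by exact: (integrable_restriction mD mb hi).
have di : intble D (fun x => h x * plateau c b x - (h \_ `]0, b[) x).
  by have := integrableB mD hpi hbi; exact.
have ndi : intble D (fun x => `|h x * plateau c b x - (h \_ `]0, b[) x|).
  by have := integrable_norm di; exact.
have Ei : intble D ((fun x => `|h x|) \_ E) by exact: (integrable_restriction mD mE ni).
rewrite hb -(RintegralB mD hpi hbi).
apply: (le_trans (le_normr_Rintegral mD di)).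
apply: (@le_trans _ _ (\int[mu]_(x in D) ((fun x => `|h x|) \_ E) x)).
  apply: (le_Rintegral mD ndi Ei) => x Dx.
  have [x0 x1] : 0 < x /\ x < 1 by move: Dx; rewrite /D /= in_itv/= => /andP.
  have [p1 p2] := @plateau_close c b x c0 x0.
  have -> : (h \_ `]0, b[) x = h x * (if x < b then 1 else 0).
    rewrite patchE; case: ltP => xb; last first.
      by rewrite memNset ?mulr0// /= in_itv/= [x < b]ltNge xb andbF.
    by rewrite mem_set ?mulr1//= in_itv/= x0.
  rewrite -mulrBr normrM patchE; case: (boolP (x \in E)) => [xE0|nE].
    have [_ xE] := set_mem xE0; rewrite ler_piMr//; apply: p1.
    case: xE => /=; rewrite in_itv/=; last by right.
    by move=> /andP[_ xE]; left.
  rewrite p2 ?subrr ?normr0 ?mulr0// => xE; move/negP: nE; apply.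
  apply: mem_set; split => //; case: xE => xE; [left|right]; rewrite /= in_itv//=.
  by rewrite xE ltW.
rewrite -Rintegral_mkcondr (_ : D `&` E = E); last first.
  by rewrite /E setIA setIid.
apply: le_trans (ler_norm _) _; apply/ltW; apply: dP => //.
exact: subIsetl.
Qed.

(** Testing against [plateau c b] and letting [c] tend to infinity: the integral
    of [u] against the derivative of the plateau tends to [u 0 - u b], and that
    of [h] against the plateau to the integral of [h] over ]0, b[. *)
Lemma weak_derivative_primitive u h b : {within `[0, 1], continuous u} ->
  u 0 = 0 -> intble D u -> intble D h -> weak_derivative u h -> 0 < b < 1 ->
  u b = \int[mu]_(x in `]0, b[) h x.
Proof.
move=> cu u0 ui hi uh b01; have /andP[b0 b1] := b01.
apply/eqP; rewrite -subr_eq0 -normr_le0; apply/ler_addgt0Pr => e' e'0.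
rewrite add0r; pose e := e' / 3.
have e0 : 0 < e by rewrite divr_gt0.
have [d1 d10 hd1] : exists2 d, 0 < d &
    forall y, 0 <= y <= 1 -> `|0 - y| < d -> `|u 0 - u y| <= e.
  by apply: within_segment_close => //; rewrite lexx ler01.
have [d2 d20 hd2] : exists2 d, 0 < d &
    forall y, 0 <= y <= 1 -> `|b - y| < d -> `|u b - u y| <= e.
  by apply: within_segment_close => //; rewrite !ltW.
have [c1 c10 hc1] := plateau_cvg b01 hi e0.
(* The terms [b^-1] and [3 / (1 - b)] keep the test function supported in
]0, 1[, and [3 / d1], [2 / d2] put the bumps where [u] is within [e] of its
values at 0 and at [b]. *)
pose c := 1 + c1 + b^-1 + 3 / (1 - b) + 3 / d1 + 2 / d2.
have b10 : 0 < 1 - b by rewrite subr_gt0.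
have p1 : 0 < b^-1 by rewrite invr_gt0.
have p2 : 0 < 3 / (1 - b) by rewrite divr_gt0.
have p3 : 0 < 3 / d1 by rewrite divr_gt0.
have p4 : 0 < 2 / d2 by rewrite divr_gt0.
have [q0 [q1 [q2 [q3 [q4 q5]]]]] :
    0 < c /\ c1 <= c /\ b^-1 <= c /\ 3 / (1 - b) <= c /\ 3 / d1 <= c /\ 2 / d2 <= c.
  by clear -c10 p1 p2 p3 p4; rewrite /c; do !split; lra.
have cb1 : 1 <= c * b by rewrite -ler_pdivrMr// div1r.
have cbc : c * b + 2 < c.
  by move: q3; rewrite ler_pdivrMr// mulrBr mulr1; move: (c * b) => cb q3; clear -q3; lra.
have cd1 : 3 <= c * d1 by rewrite -ler_pdivrMr.
have cd2 : 2 <= c * d2 by rewrite -ler_pdivrMr.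
have A : `|\int[mu]_(x in D) (u x * bump c 1 x) - 0| <= e.
  have c3 : 1 + 2 <= c by clear -cbc cb1; lra.
  apply: (bump_average q0 ler01 c3 ui) => x Dx cx.
  have /andP[x0 x1] : 0 < x < 1 by move: Dx; rewrite /D /= in_itv.
  suff : `|u 0 - u x| <= e by rewrite u0 sub0r normrN subr0.
  apply: hd1; first by rewrite !ltW.
  rewrite sub0r normrN gtr0_norm// -(ltr_pM2l q0).
  by apply: lt_le_trans cd1; clear -cx; lra.
have B : `|\int[mu]_(x in D) (u x * bump c (c * b) x) - u b| <= e.
  have cb0 : 0 <= c * b by apply: le_trans cb1.
  apply: (bump_average q0 cb0 (ltW cbc) ui) => x Dx cx.
  have /andP[x0 x1] : 0 < x < 1 by move: Dx; rewrite /D /= in_itv.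
  have /andP[cx1 cx2] := cx.
  have bx : b < x by rewrite -(ltr_pM2l q0).
  rewrite distrC; apply: hd2; first by rewrite !ltW.
  rewrite distrC gtr0_norm ?subr_gt0// -(ltr_pM2l q0) mulrBr.
  by apply: lt_le_trans cd2; clear -cx2; lra.
have C := hc1 c q1 cbc.
have bb a x : D x -> `|bump c a x| <= c.
  by move=> _; rewrite ger0_norm ?bump_ge0 ?bump_le// ltW.
have ub a := intble_bounded_mul (bump_mfun c a) (bb a) ui.
have := uh _ (plateau_test q0 cb1 cbc); rewrite derive1_plateau.
have -> : \int[mu]_(x in D) (u x * (bump c 1 x - bump c (c * b) x)) =
    \int[mu]_(x in D) (u x * bump c 1 x) - \int[mu]_(x in D) (u x * bump c (c * b) x).
  by rewrite -(RintegralB mD (ub _) (ub _)); apply: eq_Rintegral => x _; rewrite mulrBr.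
move: A B C; rewrite subr0 -/D.
move: (\int[mu]_(x in D) (u x * bump c 1 x)) (\int[mu]_(x in D) (u x * bump c (c * b) x))
  (\int[mu]_(x in D) (h x * plateau c b x)) (\int[mu]_(x in `]0, b[) h x) => X Y Z W.
clear; rewrite !ler_norml /e => /andP[? ?] /andP[? ?] /andP[? ?] XY.
by apply/andP; split; lra.
Qed.

End WeakDerivatives.

(** * The trace equation of the wave equation *)

Lemma integrable_ae_eq d (T : measurableType d) (R : realType)
    (mu : {measure set T -> \bar R}) (D : set T) (f g : T -> R) :
  measurable D -> measurable_fun D g -> ae_eq mu D f g ->
  mu.-integrable D (EFin \o f) ->
  mu.-integrable D (EFin \o g) /\ \int[mu]_(x in D) f x = \int[mu]_(x in D) g x.
Proof.
move=> mD mg fg fi; have mf := measurable_int mu fi.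
have mg' : measurable_fun D (EFin \o g) by exact/measurable_EFinP.
have fgE : ae_eq mu D (EFin \o f) (EFin \o g).
  by apply: filterS fg => x fg Dx; rewrite /= fg.
split; last by rewrite /Rintegral; congr fine; exact: ae_eq_integral.
move/integrableP : fi => [_ foo]; apply/integrableP; split => //.
rewrite -(@ae_eq_integral _ _ _ mu D _ (fun x => `|(f x)%:E|%E))//.
- exact: measurableT_comp.
- exact: measurableT_comp.
- by apply: filterS fg => x fg Dx; rewrite /= fg.
Qed.

Section TraceReduction.
Context {R : realType}.
Implicit Types (f g h : R -> R) (a b t x T : R) (p : \bar R).
Local Notation mu := (leb R).
Local Notation mes D := (@measurable _ (lebT R) D).
Local Notation mfun D f := (@measurable_fun _ _ (lebT R) R D f).
Local Notation intble D f := (mu.-integrable D (EFin \o f)).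
Local Notation sqrt2 := (Num.sqrt 2 : R).

Lemma ae_neq a : {ae mu, forall x, x != a}.
Proof.
exists [set a]; split.
- by apply: borel_leb; exact: measurable_set1.
- exact: (lebesgue_measure_set1 a).
- by move=> x /= /negP; rewrite negbK => /eqP.
Qed.

Lemma ae_all_nat (P : nat -> R -> Prop) :
  (forall n, {ae mu, forall x, P n x}) -> {ae mu, forall x, forall n, P n x}.
Proof.
move=> hP; have := negligible_bigcup hP; apply: negligibleS => x /= nP.
by apply: contrapT => h; apply: nP => n; apply: contrapT => nPn; apply: h; exists n.
Qed.

Lemma intble_aeE (D : set R) f g : mes D -> {ae mu, forall x, D x -> f x = g x} ->
  intble D f -> intble D g /\ \int[mu]_(x in D) f x = \int[mu]_(x in D) g x.
Proof.
move=> mD fg fi; have mf : mfun D f by exact/measurable_EFinP/(measurable_int mu).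
have mg := mfun_ae mD fg mf.
have fgE : ae_eq mu D f g by [].
exact: (integrable_ae_eq mD mg fgE fi).
Qed.

Lemma itv_lty a b : (mu `]a, b[%classic < +oo)%E.
Proof.
have [ab|ba] := leP a b; first by rewrite leb_oo// ltry.
by rewrite leb_itvE /= lte_fin (ltNge a b) (ltW ba)/= ltry.
Qed.

Lemma Lploc_Lp p a b T g : (1 <= p)%E -> a <= b -> Lploc p a g ->
  Lp p `]b, T[ g.
Proof.
move=> p1 ab gl; have aT : a < Num.max T (a + 1) by rewrite lt_max ltrDl ltr01 orbT.
apply: (Lp_sub p1 (leb_itv_mes _) (leb_itv_mes _) _ (gl _ aT)).
move=> x /=; rewrite !in_itv/= => /andP[bx xT].
by rewrite (le_lt_trans ab bx) lt_max xT.
Qed.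

Lemma Lploc_intble p a b T g : (1 <= p)%E -> a <= b -> Lploc p a g ->
  intble `]b, T[%classic g.
Proof.
move=> p1 ab gl; apply: (Lp_integrable p1 (leb_itv_mes _) (itv_lty _ _)).
exact: Lploc_Lp gl.
Qed.

Lemma oint_ge0 f b : 0 <= b -> intble `]0, b[%classic f ->
  oint f 0 b = \int[mu]_(x in `]0, b[) f x.
Proof. by move=> b0 fi; rewrite /oint b0 Rint_cc. Qed.

Lemma oint_lt0 f b : b < 0 -> intble `]b, 0[%classic f ->
  oint f 0 b = - \int[mu]_(x in `]b, 0[) f x.
Proof. by move=> b0 fi; rewrite /oint leNgt b0/= Rint_cc. Qed.

Lemma oint_diff f a b : a <= b -> 0 <= b -> intble `](Num.min a 0), b[%classic f ->
  oint f 0 b - oint f 0 a = \int[mu]_(x in `]a, b[) f x.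
Proof.
move=> ab b0 fi.
have ib : intble `]0, b[%classic f.
  by apply: intble_itv_sub fi => //; rewrite ge_min lexx orbT.
rewrite (oint_ge0 b0 ib); have [a0|a0] := leP 0 a.
  rewrite oint_ge0//; last exact: intble_itv_sub ib.
  by rewrite (Rint_chasles a0 ab ib) addrAC subrr add0r.
have ia : intble `]a, b[%classic f.
  by apply: intble_itv_sub fi => //; rewrite ge_min lexx.
rewrite oint_lt0//; last exact: intble_itv_sub ia.
by rewrite (Rint_chasles (ltW a0) b0 ia) opprK addrC.
Qed.

Lemma sqrt2_gt0 : 0 < sqrt2. Proof. by rewrite sqrtr_gt0. Qed.

Lemma sqrt2_sq : sqrt2 * sqrt2 = 2. Proof. by rewrite -expr2 sqr_sqrtr. Qed.

Lemma rot45_inj : injective (@rot45 R).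
Proof.
move=> [x1 x2] [y1 y2]; rewrite /rot45 /= div1r => -[E1 E2].
have i0 : sqrt2^-1 != 0 by rewrite invr_eq0 lt0r_neq0// sqrt2_gt0.
have F1 : x1 + x2 = y1 + y2 by apply: (mulfI i0); rewrite !mulrDr.
have F2 : x2 - x1 = y2 - y1.
  by apply: (mulfI i0); rewrite !mulrBr ![_ * _ - _]addrC -!mulNr.
by congr pair; lra.
Qed.

(** R maps ((f + g) / sqrt 2, (g - f) / sqrt 2) to (g, - f): in the rotated
    coordinates the boundary condition relates the wave [g] that arrives at
    x = 1 to the reflected wave [f]. *)
Lemma rot45_boundary (Sigma : set (R * R)) f g t :
  Sigma (dt f g t 1, - dx f g t 1) <->
  (@rot45 R @` Sigma) (g (t - 1), - f (t + 1)).
Proof.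
have rot : rot45 (dt f g t 1, - dx f g t 1) = (g (t - 1), - f (t + 1)).
  have i2 : sqrt2^-1 * sqrt2^-1 = 2^-1 by rewrite -invfM sqrt2_sq.
  have h (y : R) : sqrt2^-1 * sqrt2^-1 * (2 * y) = y by rewrite i2 mulKf.
  rewrite /rot45 /dt /dx /= div1r; congr pair.
    by rewrite -[RHS]h; ring.
  by rewrite -[RHS]h; ring.
split => [St|[xi Sxi]]; first by exists (dt f g t 1, - dx f g t 1).
by rewrite -rot => /rot45_inj <-.
Qed.

(** The solution at time [t] in terms of [g] when [f = - g]. *)
Definition profile g t x : R :=
  - (sqrt2^-1 * \int[mu]_(y in `](t - x), (t + x)[) g y).

(** What the wave equation says about [g] when [f = - g] on ]0, +oo[ and [S] is
    the rotated boundary relation. *)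
Definition trace_solution (S : set (R * R)) p (z0 z1 g : R -> R) : Prop :=
  [/\ Lploc p (-1) g,
      {ae mu, forall t, 0 <= t -> S (g (t - 1), g (t + 1))} &
      {ae mu, forall x, 0 < x < 1 ->
        profile g 0 x = z0 x /\ (g (- x) - g x) / sqrt2 = z1 x}].

Lemma dalembert_profile p g t x : (1 <= p)%E -> Lploc p (-1) g ->
  0 <= t -> 0 <= x <= 1 ->
  1 / sqrt2 * oint (fun y => - g y) 0 (t + x) + 1 / sqrt2 * oint g 0 (t - x) =
  profile g t x.
Proof.
move=> p1 gl t0 /andP[x0 x1].
have gi a b : -1 <= a -> intble `]a, b[%classic g by move=> a1; exact: Lploc_intble gl.
have tx0 : 0 <= t + x by rewrite addr_ge0.
have i0 : intble `]0, t + x[%classic g by apply: gi; lra.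
have iN : intble `]0, t + x[%classic (fun y => - g y).
  by have := integrableN i0; exact.
have -> : oint (fun y => - g y) 0 (t + x) = - oint g 0 (t + x).
  rewrite !oint_ge0//.
  under eq_Rintegral do rewrite -mulN1r.
  by rewrite (RintegralZl (-1) (leb_itv_mes _) i0) mulN1r.
rewrite /profile -(@oint_diff g (t - x) (t + x)) ?div1r//; last 2 first.
- by lra.
- by apply: gi; rewrite le_min; apply/andP; split; lra.
by ring.
Qed.

Lemma trace_solution_wave Sigma p z0 z1 g : (1 <= p)%E ->
  trace_solution (@rot45 R @` Sigma) p z0 z1 g ->
  wave_solution Sigma p z0 z1 (profile g).
Proof.
move=> p1 [gl gS gI]; exists (fun y => - g y), g; split.
- split=> // T T0.
  have h : Lp p `]0, T[ (fun y => -1 * g y).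
    by apply: LpZ => //; apply: Lploc_Lp gl => //; lra.
  by apply: Lp_eq h => y _; rewrite mulN1r.
- by move=> t x t0 x01; rewrite (dalembert_profile p1 gl).
- apply: aeS gS => t St t0; split; last first.
    by apply/rot45_boundary; rewrite opprK; exact: St.
  rewrite /profile subr0 addr0 set_itv_ge ?bnd_simp ?ltxx//.
  by rewrite Rintegral_set0 mulr0 oppr0.
- have h2 : {ae mu, forall x, x != 0 /\ x != 1}.
    by apply: aeS2 (ae_neq 0) (ae_neq 1) => x; split.
  apply: aeS2 gI h2 => x gx [x0 x1] /andP[x0' x1'].
  have [|<- <-] := gx; first by rewrite !lt_neqAle x0' x1' x1 eq_sym x0.
  by split => //; rewrite /dt add0r sub0r addrC.
Qed.

(** At x = 0 the solution is the primitive of [f + g], up to a factor; since it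
    vanishes, [f] can be replaced by [- g] everywhere. *)
Lemma wave_trace_solution Sigma p z0 z1 z : (1 <= p)%E ->
  wave_solution Sigma p z0 z1 z ->
  exists g, trace_solution (@rot45 R @` Sigma) p z0 z1 g /\
    forall t x, 0 <= t -> 0 <= x <= 1 -> z t x = profile g t x.
Proof.
move=> p1 [f [g [[fl gl] zE zB zI]]]; exists g.
have N10 : (-1 : R) <= 0 by lra.
have fi T : intble `]0, T[%classic f by exact: Lploc_intble fl.
have gi T : intble `]0, T[%classic g by exact: Lploc_intble gl.
have fgT T : {ae mu, forall x, 0 < x < T -> f x + g x = 0}.
  have fgi : intble `]0, T[%classic (fun x => f x + g x).
    by have := integrableD (leb_itv_mes _) (fi T) (gi T); exact.
  apply: (vanishing_ae fgi).
  apply: aeS zB => x zx /andP[x0 _].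
  have [z0' _] := zx (ltW x0); have := zE x 0 (ltW x0).
  rewrite lexx ler01 z0' addr0 subr0 => /(_ isT).
  rewrite !oint_ge0 ?ltW// -mulrDr => /esym/eqP.
  rewrite mulf_eq0 div1r invr_eq0 (negbTE (lt0r_neq0 sqrt2_gt0))/= => /eqP.
  by rewrite (RintegralD (leb_itv_mes _) (fi x) (gi x)).
have fg : {ae mu, forall x, 0 < x -> - g x = f x}.
  apply: aeS (ae_all_nat (fun n => fgT n%:R)) => x fgx x0.
  have := fgx (Num.bound x); rewrite x0 unstable.ltr_bound => /(_ isT) fg0.
  by apply/eqP; rewrite eq_sym -subr_eq0 opprK fg0.
have zP t x : 0 <= t -> 0 <= x <= 1 -> z t x = profile g t x.
  move=> t0 x01; rewrite zE// -(dalembert_profile p1 gl t0 x01).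
  congr (_ * _ + _); have /andP[x0 x1] := x01.
  have tx0 : 0 <= t + x by rewrite addr_ge0.
  have iN : intble `]0, t + x[%classic (fun y => - g y).
    by have := integrableN (gi (t + x)); exact.
  rewrite !oint_ge0//; apply/esym/(intble_aeE (leb_itv_mes _) _ iN).2.
  by apply: aeS fg => y fgy; rewrite /= in_itv/= => /andP[y0 _]; exact: fgy.
split; last exact: zP.
split => //.
- have fg1 := ae_aff 1 (or_introl erefl) fg.
  apply: aeS2 zB fg1 => t zt; rewrite /aff mul1r => ft t0.
  have [_ /rot45_boundary] := zt t0.
  by rewrite -(ft _) ?opprK//; lra.
- apply: aeS2 zI fg => x zx fx /andP[x0 x1].
  have [|zx0 zx1] := zx; first by rewrite !ltW.
  have x01 : 0 <= x <= 1 by rewrite !ltW.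
  rewrite -(zP 0 x)//; split => //.
  by rewrite -zx1 /dt add0r sub0r -(fx x0) addrC.
Qed.

End TraceReduction.

(** * The recursion on blocks of length two *)

Section Recursion.
Context {R : realType}.
Implicit Types (f g h psi phi : R -> R) (a b c s t x T : R) (p : \bar R).
Local Notation mu := (leb R).
Local Notation mes D := (@measurable _ (lebT R) D).
Local Notation mfun D f := (@measurable_fun _ _ (lebT R) R D f).
Local Notation intble D f := (mu.-integrable D (EFin \o f)).
Local Notation sqrt2 := (Num.sqrt 2 : R).

Lemma ae_and (P Q : R -> Prop) : {ae mu, forall x, P x} ->
  {ae mu, forall x, Q x} -> {ae mu, forall x, P x /\ Q x}.
Proof. by move=> hP hQ; apply: aeS2 hP hQ => x; split. Qed.

Lemma Lp_set1 p a f : (1 <= p)%E -> Lp p [set a] f.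
Proof.
move=> p1; have m1 : mes [set a] by apply: borel_leb; exact: measurable_set1.
have L : Lp p [set a] (cst (f a)).
  apply: (Lp_cst _ p1 m1).
  by rewrite (_ : mu _ = 0%E) ?ltry//; exact: (lebesgue_measure_set1 a).
by apply: Lp_eq L => x /set_mem /= ->.
Qed.

Lemma Lp_closedl p a b f : (1 <= p)%E -> a < b -> Lp p `]a, b[ f -> Lp p `[a, b[ f.
Proof.
move=> p1 ab Lf; have <- : (a |` `]a, b[)%classic = `[a, b[%classic.
  by apply: (setU1itv false); rewrite bnd_simp.
apply: (LpU p1 _ (leb_itv_mes _) _ Lf); last exact: Lp_set1.
by apply: borel_leb; exact: measurable_set1.
Qed.

Lemma preimage_aff_opp a b c :
  aff (-1) c @^-1` `]a, b[%classic = `](c - b), (c - a)[%classic.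
Proof.
by apply/seteqP; split => s; rewrite /= !in_itv/= /aff => /andP[? ?];
  apply/andP; split; lra.
Qed.

Lemma preimage_aff_shift a b c :
  aff 1 c @^-1` `[a, b[%classic = `[(a - c), (b - c)[%classic.
Proof.
by apply/seteqP; split => s; rewrite /= !in_itv/= /aff => /andP[? ?];
  apply/andP; split; lra.
Qed.

(** The index [n] of the block [2 n - 1, 2 n + 1[ that contains [s]. *)
Definition block s : nat := Num.truncn ((s + 1) / 2).

Lemma blockE (n : nat) s : n%:R * 2 - 1 <= s < n%:R * 2 + 1 -> block s = n.
Proof.
move=> /andP[ns sn]; apply: truncn_def.
by rewrite ler_pdivlMr// ltr_pdivrMr// -natr1; apply/andP; split; lra.
Qed.

(** The extension of [g0] from [-1, 1[ to [-1, +oo[ by the recursion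
    g (s + 2) = psi (g s). *)
Definition unroll psi (g0 : R -> R) s : R := iter (block s) psi (g0 (s - (block s)%:R * 2)).

Lemma unroll0 psi (g0 : R -> R) s : -1 <= s < 1 -> unroll psi g0 s = g0 s.
Proof.
move=> s1; rewrite /unroll (@blockE 0) ?mul0r ?subr0//=.
by rewrite sub0r add0r.
Qed.

Lemma unrollS psi (g0 : R -> R) s : -1 <= s -> unroll psi g0 (s + 2) = psi (unroll psi g0 s).
Proof.
move=> s1; have h : 0 <= (s + 1) / 2 by rewrite divr_ge0//; lra.
have /andP[h1 h2] := truncn_itv h; rewrite -/(block s) in h1 h2.
have bS : block (s + 2) = (block s).+1.
  apply: blockE; rewrite ler_pdivlMr// in h1; rewrite ltr_pdivrMr// in h2.
  by move: h1 h2; rewrite -natr1 => h1 h2; apply/andP; split; lra.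
rewrite /unroll bS iterS; congr (psi (iter _ _ (g0 _))).
by rewrite -natr1; lra.
Qed.

Lemma unroll_Lploc psi (g0 : R -> R) p : (1 <= p)%E ->
  (forall n, Lp p `[-1, 1[ (iter n psi \o g0)) -> Lploc p (-1) (unroll psi g0).
Proof.
move=> p1 Lit T T1.
have Lblock n : Lp p `[(n%:R * 2 - 1), (n%:R * 2 + 1)[ (unroll psi g0).
  have := Lp_aff (- (n%:R * 2)) p1 (or_introl erefl) (leb_itv_mes `[-1, 1[) (Lit n).
  have -> : aff 1 (- (n%:R * 2)) @^-1` `[(-1), 1[%classic =
            `[(n%:R * 2 - 1 : R), (n%:R * 2 + 1)[%classic.
    by rewrite preimage_aff_shift opprK [X in `[X, _[]addrC [X in `[_, X[]addrC.
  apply: Lp_eq => s /set_mem; rewrite /= in_itv/= => ns.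
  by rewrite /unroll (blockE ns) /aff mul1r.
have Lall n : Lp p `[-1, (n%:R * 2 - 1)[ (unroll psi g0).
  elim: n => [|n IH].
    rewrite mul0r sub0r; have := @Lp0 R p `[-1, -1[ p1.
    by apply: Lp_eq => s /set_mem; rewrite set_itvxx.
  have -> : `[(-1), (n.+1%:R * 2 - 1)[%classic = (`[(-1), (n%:R * 2 - 1 : R)[ `|`
      `[(n%:R * 2 - 1), (n%:R * 2 + 1)[)%classic.
    have n0 : 0 <= n%:R :> R by [].
    apply/seteqP; split => s /=; rewrite !in_itv/= -natr1.
      move=> /andP[s1 sn]; case: (ltP s (n%:R * 2 - 1)) => h; [left|right].
        by rewrite s1.
      by rewrite ?h/=; lra.
    by move=> [|] /andP[? ?]; apply/andP; split; lra.
  exact: (LpU p1 (leb_itv_mes _) (leb_itv_mes _) IH (Lblock n)).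
apply: (Lp_sub p1 (leb_itv_mes _) (leb_itv_mes _) _ (Lall (Num.bound (T + 1)))).
have TT := unstable.ltr_bound (T + 1).
have b0 : 0 <= (Num.bound (T + 1))%:R :> R by [].
move=> s /=; rewrite !in_itv/= => /andP[s1 sT]; rewrite ltW//=.
by lra.
Qed.

(** Folding the integral at 0: only the even part of [g] is visible in the
    position at time 0. *)
Lemma profile0E p g x : (1 <= p)%E -> Lploc p (-1) g -> 0 < x -> x <= 1 ->
  intble `]0, x[%classic (fun s => g (- s) + g s) /\
  profile g 0 x = - (sqrt2^-1 * \int[mu]_(s in `]0, x[) (g (- s) + g s)).
Proof.
move=> p1 gl x0 x1.
have gi a b : -1 <= a -> intble `]a, b[%classic g by move=> a1; exact: Lploc_intble gl.
have ix : intble `]-x, x[%classic g by apply: gi; lra.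
have ir : intble `]0, x[%classic g by apply: gi; lra.
have il : intble `]-x, 0[%classic g by apply: gi; lra.
have refl : aff (-1) 0 @^-1` `](-x), 0[%classic = `]0, x[%classic.
  by rewrite preimage_aff_opp !sub0r oppr0 opprK.
have N1 : (-1 : R) = 1 \/ (-1 : R) = -1 by right.
have affN s : aff (-1) 0 s = - s by rewrite /aff mulN1r addr0.
have iN : intble `]0, x[%classic (fun s => g (- s)).
  have := leb_integrable_aff 0 N1 (leb_itv_mes _) il; rewrite refl.
  by under [X in EFin \o X]funext do rewrite /= affN.
have EN : \int[mu]_(s in `]0, x[) g (- s) = \int[mu]_(s in `](-x), 0[) g s.
  rewrite -(leb_subst 0 N1 (leb_itv_mes _) il) refl.
  by apply: eq_Rintegral => s _; rewrite affN.
split; first by have := integrableD (leb_itv_mes _) iN ir; exact.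
rewrite /profile sub0r add0r (RintegralD (leb_itv_mes _) iN ir) EN.
have xN : -x <= 0 by rewrite oppr_le0 ltW.
by rewrite (Rint_chasles xN (ltW x0) ix).
Qed.

(** On ]-1, 1[ the initial data determine [g (- x) - g x], and also
    [g (- x) + g x] through its primitives. Afterwards the graph condition gives
    [g s] in terms of [g (s - 2)], and the equality spreads by unit steps. *)
Lemma trace_solution_unique phi p z0 z1 g g' : (1 <= p)%E ->
  trace_solution (fun_graph phi) p z0 z1 g ->
  trace_solution (fun_graph phi) p z0 z1 g' ->
  {ae mu, forall s, -1 < s -> g s = g' s}.
Proof.
move=> p1 [gl gS gI] [gl' gS' gI'].
have r0 : sqrt2^-1 != 0 by rewrite invr_eq0 lt0r_neq0// sqrt2_gt0.
have sums : {ae mu, forall x, 0 < x < 1 ->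
    (g (- x) + g x) - (g' (- x) + g' x) = 0}.
  apply: vanishing_ae.
    have [i1 _] := profile0E p1 gl ltr01 (lexx 1).
    have [i2 _] := profile0E p1 gl' ltr01 (lexx 1).
    by have := integrableB (leb_itv_mes _) i1 i2; exact.
  apply: aeS2 gI gI' => x gx gx' x01; have /andP[x0 x1] := x01.
  have [i1 E1] := profile0E p1 gl x0 (ltW x1).
  have [i2 E2] := profile0E p1 gl' x0 (ltW x1).
  rewrite (RintegralB (leb_itv_mes _) i1 i2); apply/eqP; rewrite subr_eq0; apply/eqP.
  apply: (mulfI r0); apply: oppr_inj; rewrite -E1 -E2.
  by have [-> _] := gx x01; have [-> _] := gx' x01.
have pos : {ae mu, forall x, 0 < x < 1 -> g x = g' x /\ g (- x) = g' (- x)}.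
  apply: aeS2 sums (ae_and gI gI') => x sx [gx gx'] x01.
  have [_ E1] := gx x01; have [_] := gx' x01; rewrite -E1 => /(mulIf r0) E.
  by have := sx x01; clear -E; split; lra.
have base : {ae mu, forall x, -1 < x < 1 -> g x = g' x}.
  have neg := ae_aff 0 (or_intror erefl) pos.
  apply: aeS2 (ae_neq 0) (ae_and pos neg) => x x0 [hp hn].
  move=> /andP[x1 x1']; have [xn|xp] := ltP x 0; last first.
    by have [] := hp; rewrite ?x1' ?andbT// lt_neqAle eq_sym x0.
  have := hn; rewrite /aff mulN1r addr0 opprK => -[]//.
  by rewrite oppr_gt0 xn ltrNl.
have step n : {ae mu, forall x, -1 < x < n.+1%:R -> g x = g' x}.
  elim: n => [|n IH]; first exact: base.
  have IH2 := ae_aff (-2) (or_introl erefl) IH.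
  have S1 := ae_aff (-1) (or_introl erefl) gS.
  have S2 := ae_aff (-1) (or_introl erefl) gS'.
  have S12 := ae_and S1 S2.
  have IH12 := ae_and IH IH2.
  have n0 : 0 <= n%:R :> R by [].
  apply: aeS2 (ae_neq 1) (ae_and IH12 S12).
  move=> x x1 [[h h2] [s s']] /andP[xN xn].
  have [xlt|xge] := ltP x n.+1%:R; first by apply: h; rewrite xN.
  have xge1 : 1 < x.
    by rewrite lt_neqAle eq_sym x1 (le_trans _ xge)// ler1n.
  move: s s' h2; rewrite /aff !mul1r subrK /fun_graph /= => s s' h2.
  have t0 : 0 <= x - 1 by rewrite subr_ge0 ltW.
  have E : x - 1 - 1 = x - 2 by ring.
  rewrite (s t0) (s' t0) E h2//; apply/andP; split; first by clear -xge1; lra.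
  by move: xn; rewrite -(natr1 n.+1); clear; lra.
apply: aeS (ae_all_nat step) => x h x1; apply: (h (Num.bound x)).
by rewrite x1/= (lt_trans (unstable.ltr_bound _))// ltr_nat.
Qed.

Lemma profile_ae p g g' t x : (1 <= p)%E -> Lploc p (-1) g ->
  {ae mu, forall s, -1 < s -> g s = g' s} -> 0 <= t -> 0 <= x <= 1 ->
  profile g t x = profile g' t x.
Proof.
move=> p1 gl gg t0 /andP[x0 x1]; rewrite /profile; congr (- (_ * _)).
have gi : intble `]t - x, t + x[%classic g by apply: Lploc_intble gl => //; lra.
apply: (intble_aeE (leb_itv_mes _) _ gi).2.
apply: aeS gg => s gs; rewrite /= in_itv/= => /andP[s1 _]; apply: gs; lra.
Qed.

End Recursion.

(** * Composition with a universally measurable function *)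

Lemma normalized_law d d' (T1 : measurableType d) (T2 : measurableType d')
    (R : realType) (m : {measure set T1 -> \bar R}) (f : T1 -> T2) :
  measurable_fun setT f -> m setT != 0%E -> (m setT < +oo)%E ->
  exists nu : probability T2 R, forall A, measurable A ->
    nu A = (m (f @^-1` A) * ((fine (m setT))^-1)%:E)%E.
Proof.
move=> mf m0 moo.
pose M : {measure set T2 -> \bar R} :=
  @measure_function_pushforward__canonical__measure_function_Measure _ _ T1 T2 R m f mf.
exists (mnormalize M (dirac point)) => A mA.
transitivity (if (m setT == 0%E) || (m setT == +oo%E) then dirac (@point T2) A
     else m (f @^-1` A) * ((fine (m setT))^-1)%:E)%E.
  change ((if (m setT == 0%E) || (m setT == +oo%E) then fun U => dirac (@point T2) U
     else fun U => m (f @^-1` U) * ((fine (m setT))^-1)%:E)%E A =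
     if (m setT == 0%E) || (m setT == +oo%E) then dirac (@point T2) A
     else m (f @^-1` A) * ((fine (m setT))^-1)%:E)%E.
  by case: ifP.
rewrite (negbTE m0) /=.
by move: moo; rewrite lt_neqAle => /andP[/negbTE ->].
Qed.

Section UniversallyMeasurable.
Context {R : realType}.
Implicit Types (A B D E N : set R) (f g h : R -> R) (phi : R -> R).
Local Notation mu := (leb R).
Local Notation mes D := (@measurable _ (lebT R) D).
Local Notation mfun D f := (@measurable_fun _ _ (lebT R) R D f).

(** For the normalized law [nu] of [f] on [D], the preimage of a Borel set by
    [phi] lies between two Borel sets whose difference is null for [nu]; their
    preimages by [f] then differ by a null set, and Lebesgue measurability is
    not sensitive to null sets. *)
Lemma um_comp phi D f : universally_measurable_fun phi -> mes D ->
  (mu D < +oo)%E -> mfun D f -> mfun D (phi \o f).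
Proof.
move=> mphi mD Doo mf _ B mB.
have [D0|D0] := eqVneq (mu D) 0%E.
  by apply: (null_all_mes mD D0); exact: subIsetl.
have mf' : @measurable_fun _ _ (lebT R) (measurableTypeR R) setT (f \_ D).
  exact: mfun_restr.
have rT : (mrestr mu mD : set (lebT R) -> \bar R) setT = mu D.
  by rewrite /mrestr setTI.
have [||nu nuE] := @normalized_law _ _ (lebT R) (measurableTypeR R) R
    (mrestr mu mD) (f \_ D) mf'.
- by rewrite [X in X != _]rT.
- by rewrite [X in (X < _)%E]rT.
have [A [C [mA mC AM MC CA0]]] := mphi B mB nu.
have mCA : @measurable _ (measurableTypeR R) (C `\` A) by exact: measurableD.
have fpos : (fine (mu D))^-1%:E != 0%E.
  rewrite eqe invr_eq0 fine_eq0// ge0_fin_numE//.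
have null : mu (D `&` f @^-1` (C `\` A)) = 0%E.
  have := nuE _ mCA; rewrite CA0 => /esym/eqP; rewrite [X in fine X]rT.
  rewrite mule_eq0 (negbTE fpos) orbF => /eqP.
  rewrite /mrestr [X in mu X = _ -> _]setIC => <-; congr (mu _).
  have fD x : D x -> (f \_ D) x = f x by move=> Dx; rewrite patchE mem_set.
  apply/seteqP; split => x [Dx h]; split => //; move: h.
    by rewrite /preimage /mkset fD.
  by rewrite /preimage /mkset fD.
have mDf X : @measurable _ (measurableTypeR R) X -> mes (D `&` f @^-1` X).
  by move=> mX; exact: mf.
have -> : D `&` (phi \o f) @^-1` B = (D `&` f @^-1` A) `|`
    (D `&` (phi \o f) @^-1` B `&` f @^-1` (C `\` A)).
  apply/seteqP; split => x /=.
    move=> [Dx Bx]; have [Ax|nAx] := pselect (A (f x)); [by left|right].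
    by split=> //; split => //; exact: MC.
  by move=> [[Dx /AM]|[]].
apply: measurableU; first exact: mDf.
apply: (null_all_mes (mDf _ mCA) null).
by move=> x /= [[Dx _] h].
Qed.

End UniversallyMeasurable.

(** * Sufficiency *)

Section Sufficiency.
Context {R : realType}.
Implicit Types (f g h psi phi : R -> R) (a b c s t x T : R) (p : \bar R).
Local Notation mu := (leb R).
Local Notation mes D := (@measurable _ (lebT R) D).
Local Notation mfun D f := (@measurable_fun _ _ (lebT R) R D f).
Local Notation intble D f := (mu.-integrable D (EFin \o f)).
Local Notation sqrt2 := (Num.sqrt 2 : R).

Lemma linear_growth_stable p phi (D : set R) f : (1 <= p)%E -> mes D ->
  (mu D < +oo)%E -> universally_measurable_fun phi -> linear_growth phi ->
  Lp p D f -> Lp p D (phi \o f).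
Proof.
move=> p1 mD Doo um [a [b [a0 b0 lin]]] Lf.
apply: (Lp_dom p1 mD Doo _ Lf (a := a) (b := b)).
  by apply: um_comp => //; exact: Lp_mfun Lf.
by apply: aeT => x _; exact: lin.
Qed.

Lemma bounded_to_bounded_stable phi (D : set R) f : mes D ->
  (mu D < +oo)%E -> universally_measurable_fun phi -> bounded_to_bounded phi ->
  Lp +oo%E D f -> Lp +oo%E D (phi \o f).
Proof.
move=> mD Doo um bb Lf; have [M hM] := Lp_oo_bound Lf.
have bM : bounded_set [set y : R | `|y| <= M].
  by exists M; split; [exact: num_real|move=> N MN y /= yM; rewrite (le_trans yM)// ltW].
have [N [_ hN]] := bb _ bM.
apply: (@Lp_oo_intro _ D _ (`|N| + 1)) => //.
  by apply: um_comp => //; exact: Lp_mfun Lf.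
apply: aeS hM => x hx Dx; apply: (hN (`|N| + 1)).
  by rewrite (le_lt_trans (ler_norm N))// ltrDl.
by exists (f x) => //; exact: hx.
Qed.

(** The solution on ]-1, 1[ of [g (- x) + g x = - sqrt 2 * h x] and
    [g (- x) - g x = sqrt 2 * z1 x] for 0 < x < 1, where [h] stands for the
    derivative of [z0]. *)
Definition dalembert_datum (z1 h : R -> R) s : R :=
  if 0 < s then - (h s + z1 s) / sqrt2 else (z1 (- s) - h (- s)) / sqrt2.

Lemma dalembert_datum_Lp p z1 h : (1 <= p)%E -> Lp p `]0, 1[ z1 -> Lp p `]0, 1[ h ->
  Lp p `[-1, 1[ (dalembert_datum z1 h).
Proof.
move=> p1 L1 Lh.
have Lneg : Lp p `](-1), 0[ (dalembert_datum z1 h).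
  have N1 : (-1 : R) = 1 \/ (-1 : R) = -1 by right.
  have Ld : Lp p `]0, 1[ (fun s => sqrt2^-1 * (z1 \+ (fun s => -1 * h s)) s).
    by apply: LpZ => //; apply: LpD => //; exact: LpZ.
  have := Lp_aff 0 p1 N1 (leb_itv_mes _) Ld; rewrite preimage_aff_opp !sub0r oppr0.
  apply: Lp_eq => s /set_mem; rewrite /= in_itv/= => /andP[_ s0].
  by rewrite /dalembert_datum /aff mulN1r addr0 ltNge (ltW s0)/= mulN1r mulrC.
have Lpos : Lp p `]0, 1[ (dalembert_datum z1 h).
  have Ld : Lp p `]0, 1[ (fun s => - sqrt2^-1 * (h \+ z1) s).
    by apply: LpZ => //; exact: LpD.
  apply: Lp_eq Ld => s /set_mem; rewrite /= in_itv/= => /andP[s0 _].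
  by rewrite /dalembert_datum s0 !mulNr mulrC.
have N10 : (-1 : R) < 0 by rewrite ltrN10.
have -> : `[(-1), 1[%classic = (`[(-1), 0[ `|` `[0, 1[)%classic :> set R.
  apply/seteqP; split => s /=; rewrite !in_itv/=.
    by move=> /andP[s1 s2]; case: (ltP s 0) => s0; [left|right]; rewrite ?s1.
  by move=> [|] /andP[s1 s2]; apply/andP; split; lra.
by apply: LpU => //; [exact: leb_itv_mes|exact: leb_itv_mes|exact: Lp_closedl|exact: Lp_closedl].
Qed.

(** All iterates of [phi] on the initial values of [g] stay in L^p, so that the
    recursion can be followed for all times. *)
Lemma graph_trace_solution p phi z0 z1 : (1 <= p)%E ->
  (forall f, Lp p `[-1, 1[ f -> Lp p `[-1, 1[ (phi \o f)) ->
  Xp p z0 z1 -> exists g, trace_solution (fun_graph phi) p z0 z1 g.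
Proof.
move=> p1 stab [[cz Lz [h [Lh wh]] z00] L1].
have r0 := lt0r_neq0 (@sqrt2_gt0 R).
pose g0 := dalembert_datum z1 h; pose g := unroll phi g0.
have Lg0 : Lp p `[-1, 1[ g0 by exact: dalembert_datum_Lp.
have gl : Lploc p (-1) g.
  apply: unroll_Lploc => //; elim => [|n IH]; first exact: Lg0.
  by have := stab _ IH.
have small x : 0 < x < 1 -> (g x = - (h x + z1 x) / sqrt2) *
    (g (- x) = (z1 x - h x) / sqrt2).
  move=> /andP[x0 x1]; rewrite /g !unroll0.
  - by rewrite /g0 /dalembert_datum x0 oppr_gt0 ltNge (ltW x0)/= opprK.
  - by clear -x0 x1; apply/andP; split; lra.
  - by clear -x0 x1; apply/andP; split; lra.
exists g; split => //.
- apply: aeT => t t0; rewrite /fun_graph /= -[in RHS]unrollS; last by clear -t0; lra.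
  by congr unroll; ring.
- apply: aeT => x x01; have [gx gNx] := small x x01.
  split; last first.
    rewrite gx gNx (_ : _ / _ = 2 * z1 x / (sqrt2 * sqrt2)); last by field.
    by rewrite sqrt2_sq mulrC mulKf.
  have Doo := @itv_lty R 0 1.
  have zi := Lp_integrable p1 (leb_itv_mes _) Doo Lz.
  have hi := Lp_integrable p1 (leb_itv_mes _) Doo Lh.
  rewrite (weak_derivative_primitive cz z00 zi hi wh x01).
  have /andP[x0 x1] := x01; rewrite (profile0E p1 gl x0 (ltW x1)).2.
  have hix : intble `]0, x[%classic h.
    by apply: intble_itv_sub hi => //; case/andP: x01 => _ /ltW.
  rewrite (@eq_Rintegral _ _ _ mu _ (fun s => - sqrt2 * h s)); last first.
    move=> s /set_mem; rewrite /= in_itv/= => /andP[s0 sx].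
    have s01 : 0 < s < 1 by rewrite s0/= (lt_trans sx)//; case/andP: x01.
    rewrite !(small s s01) (_ : _ + _ = - (2 * h s / sqrt2)); last by field.
    have -> : 2 * h s = sqrt2 * sqrt2 * h s by rewrite sqrt2_sq.
    by field.
  by rewrite (RintegralZl (- sqrt2) (leb_itv_mes _) hix) mulNr mulrN opprK mulKf.
Qed.

Lemma graph_solvable (Sigma : set (R * R)) p phi z0 z1 : (1 <= p)%E ->
  (@rot45 R) @` Sigma = fun_graph phi ->
  (forall f, Lp p `[-1, 1[ f -> Lp p `[-1, 1[ (phi \o f)) ->
  Xp p z0 z1 -> exists_unique_solution Sigma p z0 z1.
Proof.
move=> p1 SE stab X; have [g gP] := graph_trace_solution p1 stab X.
have wg : wave_solution Sigma p z0 z1 (profile g).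
  by apply: trace_solution_wave => //; rewrite SE.
exists (profile g); split => // z' wz' t x t0 x01.
have [g' [g'P ->//]] := wave_trace_solution p1 wz'.
rewrite SE in g'P; have [gl' _ _] := g'P.
apply: (profile_ae p1 gl') => //; exact: trace_solution_unique g'P gP.
Qed.

End Sufficiency.

(** * Quantile functions *)

Section Quantile.
Context {R : realType} (nu : probability (measurableTypeR R) R).

(* A random variable with law [nu], whose distribution function is [F]. *)
Let idR : measurableTypeR R -> R := idfun.
#[local] HB.instance Definition _ :=
  @isMeasurableFun.Build _ _ _ _ idR (@measurable_id _ _ setT).

Let F r := fine (nu `]-oo, r]%classic).

Let mI (i : interval R) : @measurable _ (measurableTypeR R) [set` i].
Proof. exact: measurable_itv. Qed.

Let FE r : (F r)%:E = nu `]-oo, r]%classic.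
Proof. by rewrite /F fineK// fin_num_measure. Qed.

Let cdfE r : cdf (idR : {RV nu >-> R}) r = (F r)%:E.
Proof. by rewrite FE /cdf /distribution /pushforward preimage_id. Qed.

Let Fnd x y : x <= y -> F x <= F y.
Proof. by move=> xy; rewrite -lee_fin -!cdfE cdf_nondecreasing. Qed.

Let Fcvg (G : set_system R) (l : R) : Filter G ->
  cdf (idR : {RV nu >-> R}) @ G --> l%:E -> F @ G --> l.
Proof.
move=> FG h; apply: fine_cvg; apply: cvg_trans h; apply: near_eq_cvg.
by apply: nearW => x; rewrite cdfE FE.
Qed.

Let F1 u : u < 1 -> exists x, u <= F x.
Proof.
move=> u1; have h := cvgr_gt _ (Fcvg _ (cvg_cdfy1 (idR : {RV nu >-> R}))) _ u1.
near (+oo%R : set_system R) => x; exists x; apply/ltW; near: x.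
exact: h.
Unshelve. all: by end_near. Qed.

Let F0 u : 0 < u -> exists x, forall y, u <= F y -> x <= y.
Proof.
move=> u0; have h := cvgr_lt _ (Fcvg _ (cvg_cdfNy0 (idR : {RV nu >-> R}))) _ u0.
near (-oo%R : set_system R) => x; exists x => y uFy.
rewrite leNgt; apply/negP => yx.
have : F x < u by near: x; exact: h.
by rewrite ltNge (le_trans uFy)// Fnd// ltW.
Unshelve. all: by end_near. Qed.

Let Frc u a : (forall x, a < x -> u <= F x) -> u <= F a.
Proof.
move=> h; rewrite leNgt; apply/negP => Fau.
have := @cdf_right_continuous _ _ _ nu (idR : {RV nu >-> R}) a; rewrite cdfE.
move=> /Fcvg hF; have hlt := cvgr_lt _ hF _ Fau.
near a^'+ => x.
have : F x < u by near: x; exact: hlt.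
by rewrite ltNge h.
Unshelve. all: by end_near. Qed.

Definition quantile u := inf [set x | u <= fine (nu `]-oo, x]%classic)].

(** The distribution function is right continuous, so the infimum that defines
    the quantile is attained. *)
Lemma quantile_le u x : 0 < u < 1 -> (quantile u <= x) = (u <= F x).
Proof.
move=> /andP[u0 u1].
have hi : has_inf [set x | u <= F x].
  split; first by have [y] := F1 u1; exists y.
  by have [y hy] := F0 u0; exists y => z /= /hy.
apply/idP/idP => [qx|ux]; last by apply: ge_inf => //; case: hi.
apply: (@le_trans _ _ (F (quantile u))); last exact: Fnd.
apply: Frc => y qy.
have yq0 : 0 < y - quantile u by rewrite subr_gt0.
have [z /= uz] := inf_adherent yq0 hi; rewrite -/(quantile u) subrKC => zy.
by apply: (le_trans uz); apply: Fnd; exact: ltW.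
Qed.

Let D : set R := `]0, 1[%classic.

Lemma quantile_measurable :
  @measurable_fun _ _ (measurableTypeR R) (measurableTypeR R) D quantile.
Proof.
move=> mD; apply: (measurability _ (RGenOInfty.measurableE R)) => //.
move=> _ [_ [x ->] <-].
rewrite (_ : _ `&` _ = D `&` `]F x, +oo[%classic).
  by apply: measurableI; exact: mI.
apply/seteqP; split => u [Du] /=; rewrite !in_itv/= !andbT => h; split => //.
  by rewrite ltNge -quantile_le -?ltNge//; move: Du; rewrite /D /= in_itv.
by rewrite ltNge quantile_le -?ltNge//; move: Du; rewrite /D /= in_itv.
Qed.

(** The preimage of ]x, +oo[ in ]0, 1[ is ]F x, 1[, of length
    [1 - F x = nu ]x, +oo[], and the values on rays determine the measure. *)
Lemma quantile_law (A : set R) : @measurable _ (measurableTypeR R) A ->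
  @lebesgue_measure R (D `&` quantile @^-1` A) = nu A.
Proof.
move=> mA.
have mq : @measurable_fun _ _ (measurableTypeR R) (measurableTypeR R) setT (quantile \_ D).
  have mD : @measurable _ (measurableTypeR R) D by exact: mI.
  apply: (@measurable_restrictT _ _ (measurableTypeR R) (measurableTypeR R) D quantile mD).1.
  exact: quantile_measurable.
pose M : {measure set (measurableTypeR R) -> \bar R} :=
  @measure_function_pushforward__canonical__measure_function_Measure _ _ (measurableTypeR R) (measurableTypeR R) R
  (mrestr (@lebesgue_measure R) (mI `]0, 1[)) (quantile \_ D) mq.
have ME B : M B = @lebesgue_measure R (D `&` quantile @^-1` B).
  have -> : M B = @lebesgue_measure R ((quantile \_ D) @^-1` B `&` D) := erefl.
  have qD x : D x -> (quantile \_ D) x = quantile x by move=> Dx; rewrite patchE mem_set.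
  congr (lebesgue_measure _); rewrite setIC.
  apply/seteqP; split => x [Dx h]; split => //; move: h.
    by rewrite /preimage /mkset qD.
  by rewrite /preimage /mkset qD.
rewrite -ME; apply: (@measure_unique _ R (measurableTypeR R) (@RGenOInfty.G R)
  (fun k => `](- k%:R), +oo[%classic) _ _ _ _ M nu) => //.
- exact: RGenOInfty.measurableE.
- move=> _ _ [x ->] [y ->]; exists (Num.max x y).
  by apply/seteqP; split => z /=; rewrite !in_itv/= !andbT gt_max;
      [move=> [-> ->]|move=> /andP[]].
- by move=> k; exists (- k%:R).
- apply/seteqP; split => // x _; exists (Num.bound x) => //=.
  by rewrite in_itv/= andbT ltrNl unstable.ltrNbound.
- move=> _ [x ->]; rewrite ME.
  have F01 : 0 <= F x <= 1.
    by rewrite -!lee_fin FE measure_ge0 probability_le1.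
  have /andP[F0' F1'] := F01.
  rewrite (_ : _ `&` _ = `]F x, 1[%classic); last first.
    apply/seteqP; split => u /=; rewrite /D /= !in_itv/= !andbT.
      by move=> [u01]; rewrite ltNge quantile_le// -ltNge => ->; case/andP: u01.
    move=> /andP[Fu u1]; have u01 : 0 < u < 1 by rewrite (le_lt_trans F0' Fu).
    by split => //; rewrite ltNge quantile_le// -ltNge.
  rewrite lebesgue_measure_itv/= lte_fin -setCitvl probability_setC ?FE//.
  rewrite -FE -EFinB; case: ltP => // F1''.
  by rewrite (_ : F x = 1) ?subrr//; apply/eqP; rewrite eq_le F1' F1''.
- move=> k; rewrite ME.
  apply: (@le_lt_trans _ _ (@lebesgue_measure R D)).
    apply: le_measure; rewrite ?inE//; first exact: (quantile_measurable (mI _) (mI _)).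
    exact: mI.
  by rewrite lebesgue_measure_itv/= lte01 sube0 ltry.
Qed.

End Quantile.

(** * Preserving L^p forces universal measurability *)

Section NecessaryMeasurability.
Context {R : realType}.
Implicit Types (A B D E N : set R) (f g h q : R -> R) (phi : R -> R).
Local Notation mu := (leb R).
Local Notation mes D := (@measurable _ (lebT R) D).
Local Notation bor D := (@measurable _ (measurableTypeR R) D).
Local Notation mfun D f := (@measurable_fun _ _ (lebT R) R D f).
Local Notation bfun D f := (@measurable_fun _ _ (measurableTypeR R) R D f).

(** By Lusin's theorem [E] is, up to a null set, a countable union of compact
    sets on which [q] is continuous; their images are compact, hence Borel. *)
Lemma inner_image D q E : bor D -> (mu D < +oo)%E -> bfun D q ->
  mes E -> E `<=` D ->
  exists A, [/\ bor A, A `<=` q @` E & mu (E `\` q @^-1` A) = 0%E].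
Proof.
move=> bD Doo mq mE ED.
have [E0 [N [bE0 nN _ EE]]] := leb_decomp mE.
have E0E : E0 `<=` E by rewrite EE; exact: subsetUl.
have E0D : E0 `<=` D by exact: subset_trans ED.
have E0oo : (@lebesgue_measure R E0 < +oo)%E.
  apply: le_lt_trans Doo; rewrite -[X in (X <= _)%E]/(mu E0).
  by apply: (@le_measure _ _ _ mu); rewrite ?inE//; exact: borel_leb.
have mqE : bfun E0 q by exact: measurable_funS mq.
have inv0 n : 0 < n.+1%:R^-1 :> R by rewrite invr_gt0.
have Kex n := measurable_almost_continuous bE0 E0oo (inv0 n) mqE.
pose K n := projT1 (cid (Kex n)); have KP n := projT2 (cid (Kex n)).
have cK n : compact (K n) by have [] := KP n.
have bK n : bor (K n) by apply: compact_measurable; exact: cK.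
have bqK n : bor (q @` K n).
  apply: compact_measurable; apply: continuous_compact => //.
  by have [] := KP n.
have bA : bor (\bigcup_n (q @` K n)) by exact: bigcupT_measurable.
exists (\bigcup_n (q @` K n)); split => //.
  move=> _ [n _ [x Kx <-]]; exists x => //; apply: E0E.
  by have [_ + _ _] := KP n; exact.
set A := \bigcup_n _ in bA *.
have bEA : bor (E0 `\` q @^-1` A).
  rewrite (_ : _ `\` _ = E0 `&` q @^-1` (~` A)); last by rewrite setDE.
  by apply: mqE => //; exact: measurableC.
have EA0 : mu (E0 `\` q @^-1` A) = 0%E.
  apply/eqP; rewrite eq_le measure_ge0 andbT.
  apply/lee_addgt0Pr => e e0; rewrite add0e.
  have [n ne] : exists n, n.+1%:R^-1 < e.
    by exists (Num.truncn e^-1); rewrite invf_plt ?posrE// truncnS_gt.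
  apply: (@le_trans _ _ (n.+1%:R^-1)%:E); last by rewrite lee_fin ltW.
  apply: (@le_trans _ _ (@lebesgue_measure R (E0 `\` K n))).
    apply: (@le_measure _ _ _ mu); rewrite ?inE.
    - exact: borel_leb.
    - by apply: borel_leb; exact: measurableD.
    - by move=> x [E0x nA]; split => // Kx; apply: nA; exists n => //; exists x.
  by have [_ _ /ltW] := KP n.
have mN : mes N by exact: leb_null_mes.
have N0 := (negligibleP _ mN).1 nN.
have mU : mes ((E0 `\` q @^-1` A) `|` N).
  by apply: measurableU => //; exact: borel_leb.
have U0 : mu ((E0 `\` q @^-1` A) `|` N) = 0%E.
  apply/eqP; rewrite eq_le measure_ge0 andbT.
  apply: (le_trans (measureU2 mu (borel_leb bEA) mN)).
  by rewrite [X in (X + _)%E]EA0 [X in (_ + X)%E]N0 adde0.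
have sub : E `\` q @^-1` A `<=` (E0 `\` q @^-1` A) `|` N.
  by rewrite EE => x [[E0x|Nx] nA]; [left|right].
apply/eqP; rewrite eq_le measure_ge0 andbT -[leRHS]U0.
by apply: le_measure; rewrite ?inE//; exact: null_all_mes sub.
Qed.

(** Let [q] be the quantile function of [nu] and [E] the set of points of ]0, 1[
    where [phi \o q] is in [B], which is Lebesgue measurable by stability. Borel
    subsets of the images by [q] of [E] and of its complement that exhaust them
    up to null sets lie in the preimage of [B] by [phi], respectively in its
    complement, and leave out a set whose preimage by [q] is null. *)
Lemma stable_universally_measurable p phi : (1 <= p)%E ->
  (forall g, Lp p `]0, 1[ g -> Lp p `]0, 1[ (phi \o g)) ->
  universally_measurable_fun phi.
Proof.
move=> p1 stab B bB nu.
set D : set R := `]0, 1[%classic.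
have bD : bor D by exact: measurable_itv.
have mD : mes D by exact: leb_itv_mes.
have Doo : (mu D < +oo)%E by rewrite leb_oo// ltry.
pose q := quantile nu.
have bq : bfun D q by exact: quantile_measurable.
(* [q] need not be in L^p, but its truncations are bounded. *)
pose tr (n : nat) (x : R) := if `|x| <= n%:R then x else 0.
have btr n : bfun setT (tr n).
  apply: (@measurable_fun_ifT _ _ (measurableTypeR R) R _ (cst 0)) => //.
  apply: (@measurable_fun_ler _ (measurableTypeR R)) => //.
have mE : mes (D `&` (phi \o q) @^-1` B).
  rewrite (_ : _ `&` _ = \bigcup_n (D `&` q @^-1` `[- n%:R, n%:R]
      `&` (D `&` (phi \o (tr n \o q)) @^-1` B))); last first.
    have trq n x : `|q x| <= n%:R -> tr n (q x) = q x by rewrite /tr => ->.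
    apply/seteqP; split => x /=.
      move=> [Dx Bx]; exists (Num.bound (q x)) => //=.
      have qn : `|q x| <= (Num.bound (q x))%:R by rewrite ltW// unstable.ltr_norm_bound.
      by rewrite /= in_itv/= -ler_norml qn trq.
    by move=> [n _ /= [[Dx]]]; rewrite in_itv/= -ler_norml => qn [_]; rewrite trq.
  apply: bigcupT_measurable => n; apply: measurableI.
    by apply: (borel_mfun bD bq) => //; exact: measurable_itv.
  have Lq : Lp p D (tr n \o q).
    apply: (@Lp_bounded _ p D _ n%:R) => //.
      by apply: (borel_mfun bD); apply: (@measurableT_comp _ _ _ (measurableTypeR R) (measurableTypeR R) R (tr n)) => //.
    by move=> x _; rewrite /= /tr; case: ifP => // _; rewrite normr0.
  exact: (Lp_mfun mD (stab _ Lq)).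
set E := _ `&` _ in mE.
have ED : E `<=` D by exact: subIsetl.
have mDE : mes (D `\` E) by exact: measurableD.
have [A [bA AE EA0]] := inner_image bD Doo bq mE ED.
have [A' [bA' AE' EA0']] := inner_image bD Doo bq mDE (@subDsetl _ D E).
(* Points of the gap lie neither in [A] nor in [A'], so their preimages by [q]
lie in the null sets left out by [A] and [A']. *)
exists A, (~` A'); split => //.
- exact: measurableC.
- by move=> y /AE [x [_ Bx] <-].
- by move=> y By /AE' [x [Dx nE] xy]; apply: nE; split => //=; rewrite xy.
- rewrite -quantile_law; last by apply: measurableD => //; exact: measurableC.
  apply/eqP; rewrite eq_le measure_ge0 andbT.
  have mqA C : bor C -> mes (D `&` q @^-1` C).
    by move=> bC; exact: (borel_mfun bD bq).
  have m1 : mes (E `\` q @^-1` A).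
    rewrite (_ : _ `\` _ = E `\` (D `&` q @^-1` A)).
      by apply: measurableD => //; exact: mqA.
    apply/seteqP; split => x [Ex nA]; split => //; first by move=> [_ /nA].
    by move=> Ax; apply: nA; split => //; exact: ED.
  have m2 : mes (D `\` E `\` q @^-1` A').
    rewrite (_ : _ `\` _ = D `\` E `\` (D `&` q @^-1` A')).
      by apply: measurableD => //; exact: mqA.
    apply/seteqP; split => x [[Dx nE] nA]; split => //; first by move=> [_ /nA].
    by move=> Ax; apply: nA; split.
  apply: (@le_trans _ _ (mu ((E `\` q @^-1` A) `|` (D `\` E `\` q @^-1` A')))).
    apply: (@le_measure _ _ _ mu); rewrite ?inE.
    - by apply: mqA; apply: measurableD => //; exact: measurableC.
    - exact: measurableU.
    - move=> x [Dx [nA' nA]]; have [Ex|nE] := pselect (E x); [by left|right].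
      by split.
  apply: (le_trans (measureU2 mu m1 m2)).
  by rewrite [X in (X + _)%E]EA0 [X in (_ + X)%E]EA0' adde0.
Qed.

End NecessaryMeasurability.

(** * Preserving L^p forces the growth condition *)

Section NecessaryGrowth.
Context {R : realType}.
Implicit Types (A B D E N : set R) (f g h q : R -> R) (phi : R -> R).
Local Notation mu := (leb R).
Local Notation mes D := (@measurable _ (lebT R) D).
Local Notation bor D := (@measurable _ (measurableTypeR R) D).
Local Notation mfun D f := (@measurable_fun _ _ (lebT R) R D f).

(* The intervals ]w n, 2 * w n[ are pairwise disjoint in ]0, 1[. *)
Let w n : R := ((2 ^ n.+1)%N%:R)^-1.

Let w_gt0 n : 0 < w n. Proof. by rewrite invr_gt0 ltr0n expn_gt0. Qed.

Let w_double n : w n.+1 + w n.+1 = w n.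
Proof.
have -> : w n.+1 = w n / 2 by rewrite /w expnS natrM invfM mulrC.
by rewrite -splitr.
Qed.

Let w_le n m : (n <= m)%N -> w m <= w n.
Proof. by move=> nm; rewrite lef_pV2 ?posrE ?ltr0n ?expn_gt0// ler_nat leq_exp2l. Qed.

Let w_le1 n : w n + w n <= 1.
Proof.
apply: (@le_trans _ _ (w 0 + w 0)); first by rewrite lerD// w_le.
by rewrite /w expn1 [leRHS]splitr div1r.
Qed.

Definition spike (l : nat -> R) n : set R := `]w n, w n + l n[%classic.

Section Spikes.
Variables (x l : nat -> R).
Hypothesis l_bound : forall n, 0 < l n <= w n.

Lemma spike_disjoint n m t : spike l n t -> spike l m t -> n = m.
Proof.
wlog nm : n m / (n < m)%N => [hw|].
  have [nm|mn|//] := ltngtP n m; first exact: hw.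
  by move=> tn tm; apply/esym/(hw m n).
rewrite /spike /= !in_itv/= => /andP[wt _] /andP[_ tw].
have /andP[_ lm] := l_bound m.
have : w m + l m <= w n.
  apply: (@le_trans _ _ (w m + w m)); first by rewrite lerD2l.
  by case: m nm {tw lm} => // m nm; rewrite w_double w_le.
by move=> /(lt_le_trans tw) /(lt_trans wt); rewrite ltxx.
Qed.

Lemma spike01 n : spike l n `<=` `]0, 1[%classic.
Proof.
move=> t; rewrite /spike /= !in_itv/= => /andP[wt tw].
rewrite (lt_trans (w_gt0 n) wt)/= (lt_le_trans tw)//.
have /andP[_ ln] := l_bound n.
by apply: le_trans (w_le1 n); rewrite lerD2l.
Qed.

Definition spiky (t : R) : R :=
  if pselect (exists n, spike l n t) is left h then x (projT1 (cid h)) else 0.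

Lemma spiky_in n t : spike l n t -> spiky t = x n.
Proof.
move=> tn; rewrite /spiky; case: pselect => [h|[]]; last by exists n.
by case: cid => m /= tm; rewrite (spike_disjoint tm tn).
Qed.

Lemma spiky_out t : ~ (\bigcup_n spike l n) t -> spiky t = 0.
Proof.
move=> h; rewrite /spiky; case: pselect => // -[n tn].
by exfalso; apply: h; exists n.
Qed.

Lemma spiky_borel : @measurable_fun _ _ (measurableTypeR R) R setT spiky.
Proof.
have bspike n : bor (spike l n) by exact: measurable_itv.
move=> _ Y mY; rewrite setTI.
rewrite (_ : _ @^-1` _ = (\bigcup_(n in [set n | Y (x n)]) spike l n) `|`
    (if pselect (Y 0) then ~` (\bigcup_n spike l n) else set0)).
  apply: measurableU; first by apply: bigcup_measurable => n _.
  case: pselect => [Y0|nY0]; last exact: measurable0.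
  apply: measurableC.
  by apply: bigcup_measurable => n _.
apply/seteqP; split => t /=.
  have [[n _ tn]|nt] := pselect ((\bigcup_n spike l n) t).
    by rewrite (spiky_in tn) => Yx; left; exists n.
  by rewrite spiky_out// => Y0; right; case: pselect.
move=> [[n Yx tn]|]; first by rewrite (spiky_in tn).
by case: pselect => // Y0 nt; rewrite spiky_out.
Qed.

Lemma spiky_mfun D : mes D -> mfun D spiky.
Proof.
move=> mD; apply: (@measurable_funTS _ _ (lebT R) R D).
by apply: borel_mfun => //; exact: spiky_borel.
Qed.

Lemma mu_spike n : mu (spike l n) = (l n)%:E.
Proof.
have /andP[l0 _] := l_bound n.
rewrite /spike (_ : l n = w n + l n - w n); last by rewrite addrAC subrr add0r.
by rewrite {1}(_ : w n + l n - w n = l n) ?leb_oo ?lerDl ?ltW// addrAC subrr add0r.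
Qed.

Lemma int_spike n (h : R -> \bar R) (c : R) : (forall t, spike l n t -> h t = c%:E) ->
  (\int[mu]_(t in spike l n) h t = (c * l n)%:E)%E.
Proof.
move=> hc; rewrite (eq_integral (cst c%:E)); last by move=> t /set_mem /hc.
by rewrite integral_cst ?mu_spike//; exact: leb_itv_mes.
Qed.

Lemma spiky_Lp r : 1 <= r -> (forall n, `|x n| `^ r * l n <= w n) ->
  Lp r%:E `]0, 1[ spiky.
Proof.
move=> r1 xl.
have r0 : r != 0 by rewrite gt_eqF// (lt_le_trans ltr01).
set D : set R := `]0, 1[%classic.
have mD : mes D by exact: leb_itv_mes.
apply: int_Lp_fin => //; first exact: spiky_mfun.
have mS n : mes (spike l n) by exact: leb_itv_mes.
set U := \bigcup_n spike l n.
have mU : mes U by exact: bigcupT_measurable.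
have UD : U `<=` D by move=> t [n _ /spike01].
have mh E : mes E -> @measurable_fun _ _ (lebT R) _ E (fun t => (`|spiky t| `^ r)%:E).
  by move=> mE; apply: powR_measurable; exact: spiky_mfun.
have -> : (\int[mu]_(t in D) (`|spiky t| `^ r)%:E =
           \int[mu]_(t in U) (`|spiky t| `^ r)%:E)%E.
  rewrite integral_mkcond [RHS]integral_mkcond; apply: eq_integral => t _.
  rewrite !patchE; case: (boolP (t \in U)) => tU.
    by rewrite mem_set//; apply: UD; exact: set_mem.
  case: ifP => // _; rewrite spiky_out ?normr0 ?powR0//.
  by move=> /mem_set; apply/negP.
have tS : trivIset setT (spike l).
  by move=> n m _ _ [t [tn tm]]; exact: (spike_disjoint tn tm).
have h0 t : U t -> (0 <= (`|spiky t| `^ r)%:E)%E by rewrite lee_fin powR_ge0.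
rewrite (ge0_integral_bigcup mu mS (mh _ mU) h0 tS).
apply: (@le_lt_trans _ _ (\sum_(n <oo) (1 / (2 ^ n.+1)%N%:R)%:E)%E).
  apply: lee_nneseries => [n _ _|n _]; first exact: integral_ge0.
  rewrite (int_spike (c := `|x n| `^ r)); last by move=> t /spiky_in ->.
  by rewrite lee_fin div1r; exact: xl.
by apply: (le_lt_trans (epsilon_trick0 _ _)) => //; exact: ltry.
Qed.

End Spikes.

(** Suppose [`|phi (x n)| > 4 ^ n * (`|x n| + 1)]. A spike of height [x n] and of
    length [2 ^ - (n + 1) / (`|x n| + 1) ^ r] contributes at most [2 ^ - (n + 1)]
    to the integral of the r-th power of the spiky function, but at least
    [4 ^ n * 2 ^ - (n + 1) = 2 ^ n / 2] to that of its image. *)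
Lemma stable_linear_growth r phi : 1 <= r ->
  (forall g, Lp r%:E `]0, 1[ g -> Lp r%:E `]0, 1[ (phi \o g)) ->
  linear_growth phi.
Proof.
move=> r1 stab; apply: contrapT => nlin.
have big n : exists y, 4 ^+ n * (`|y| + 1) < `|phi y|.
  apply: contrapT => ny; apply: nlin; exists (4 ^+ n), (4 ^+ n); split.
  - exact: exprn_ge0.
  - exact: exprn_ge0.
  - move=> y; rewrite leNgt; apply/negP => hy; apply: ny; exists y.
    by rewrite mulrDr mulr1.
pose x n := projT1 (cid (big n)); have xP n := projT2 (cid (big n)).
pose l n := w n / (`|x n| + 1) `^ r.
have a1 n : 1 <= `|x n| + 1 by rewrite lerDr.
have r0 : 0 <= r by exact: le_trans r1.
have p1 n : 1 <= (`|x n| + 1) `^ r.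
  rewrite [leLHS](_ : 1 = 1 `^ r); last by rewrite powR1.
  by rewrite ge0_ler_powR// nnegrE.
have p0 n : 0 < (`|x n| + 1) `^ r by exact: lt_le_trans (p1 n).
have lb n : 0 < l n <= w n.
  rewrite /l divr_gt0//= ler_pdivrMr//.
  by rewrite ler_peMr// ltW.
have Lg : Lp r%:E `]0, 1[ (spiky x l).
  apply: spiky_Lp => // n; rewrite /l mulrCA ger_pMr// ler_pdivrMr// mul1r.
  by rewrite ge0_ler_powR// ?nnegrE ?addr_ge0// lerDl.
have := stab _ Lg.
set D : set R := `]0, 1[%classic => Lphi.
have mD : mes D by exact: leb_itv_mes.
have := Lp_fin_int r1 mD Lphi.
set I := (\int[mu]_(_ in _) _)%E => Ioo.
have mphi := Lp_mfun mD Lphi.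
have I0 : (0 <= I)%E by exact: integral_ge0.
have Ige n : ((2 ^+ n / 2)%:E <= I)%E.
  apply: (@le_trans _ _ (\int[mu]_(t in spike l n) (`|(phi \o spiky x l) t| `^ r)%:E)%E).
    rewrite (int_spike lb (c := `|phi (x n)| `^ r)); last first.
      by move=> t /(spiky_in x lb) /= ->.
    rewrite lee_fin /l mulrA ler_pdivlMr//.
    apply: (@le_trans _ _ ((4 ^+ n * (`|x n| + 1)) `^ r * w n)); last first.
      rewrite ler_pM2r// ge0_ler_powR// ?nnegrE ?mulr_ge0 ?exprn_ge0 ?addr_ge0//.
      exact/ltW/xP.
    rewrite powRM ?exprn_ge0 ?addr_ge0// [leRHS]mulrAC ler_pM2r//.
    apply: (@le_trans _ _ (4 ^+ n * w n)); last first.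
      rewrite ler_pM2r// -[leLHS]powRr1 ?exprn_ge0// ler_powR//.
      by rewrite exprn_ege1// ler1n.
    have a0 : 2 ^+ n != 0 :> R by rewrite expf_neq0// pnatr_eq0.
    rewrite /w natrX exprS (_ : 4 = 2 * 2 :> R) ?exprMn; last by rewrite -natrM.
    by rewrite le_eqVlt; apply/orP; left; apply/eqP; field.
  have mS : mes (spike l n) by exact: leb_itv_mes.
  apply: (ge0_subset_integral mu mS mD (powR_measurable r mphi)).
    by move=> t _; rewrite lee_fin powR_ge0.
  exact: (spike01 lb).
have I0' : 0 <= fine I by exact: fine_ge0.
have : 2 ^+ (Num.bound (2 * fine I)) / 2 <= fine I.
  by rewrite -lee_fin fineK ?Ige// ge0_fin_numE.
rewrite ler_pdivrMr// mulrC leNgt => /negP; apply.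
apply: (lt_le_trans (unstable.ltr_bound _)).
by rewrite -natrX ler_nat ltnW// ltn_expl.
Qed.

(** If [phi] is unbounded on a bounded set, spikes with heights in that set form
    a bounded function whose image is not essentially bounded. *)
Lemma stable_bounded phi :
  (forall g, Lp +oo%E `]0, 1[ g -> Lp +oo%E `]0, 1[ (phi \o g)) ->
  bounded_to_bounded phi.
Proof.
move=> stab A bA; apply: contrapT => nb.
have big n : exists2 y, A y & n%:R < `|phi y|.
  apply: contrapT => ny; apply: nb; exists n%:R; split; first by [].
  move=> M nM _ [y Ay <-] /=; rewrite (le_trans _ (ltW nM))//.
  by rewrite leNgt; apply/negP => hy; apply: ny; exists y.
pose x n := projT1 (cid2 (big n)).
have xA n : A (x n) by rewrite /x; case: cid2.
have xP n : n%:R < `|phi (x n)| by rewrite /x; case: cid2.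
have lb n : 0 < w n <= w n by rewrite w_gt0 lexx.
set D : set R := `]0, 1[%classic in stab *.
have mD : mes D by exact: leb_itv_mes.
have [M [_ MA]] := bA.
have {}MA y : A y -> `|y| <= `|M| + 1.
  by apply: (MA (`|M| + 1)); rewrite (le_lt_trans (ler_norm M))// ltrDl.
have Lg : Lp +oo%E D (spiky x w).
  apply: (@Lp_oo_intro _ D _ (`|M| + 1)) => //; first exact: spiky_mfun.
  apply: aeT => t _; have [[n _ tn]|nt] := pselect ((\bigcup_n spike w n) t).
    by rewrite (spiky_in x lb tn) MA.
  by rewrite spiky_out// normr0 addr_ge0.
have [C hC] := Lp_oo_bound (stab _ Lg).
have wn n : w n < w n + w n by rewrite ltrDl.
have [t [tn]] := ae_exists (wn (Num.bound C)) hC.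
have tS : spike w (Num.bound C) t by rewrite /spike /= in_itv.
move=> /(_ (spike01 lb tS)); rewrite /= (spiky_in x lb tS).
move=> /(lt_le_trans (xP _)).
by move=> /lt_trans /(_ (unstable.ltr_bound _)); rewrite ltxx.
Qed.

End NecessaryGrowth.

(** * Well-posedness forces a graph *)

Section Necessity.
Context {R : realType}.
Implicit Types (Sigma : set (R * R)) (p : \bar R) (f g h psi phi : R -> R) (a b c s t x T : R).
Local Notation mu := (leb R).
Local Notation mes D := (@measurable _ (lebT R) D).
Local Notation mfun D f := (@measurable_fun _ _ (lebT R) R D f).
Local Notation intble D f := (mu.-integrable D (EFin \o f)).
Local Notation sqrt2 := (Num.sqrt 2 : R).
Local Notation rot Sigma := ((@rot45 R) @` Sigma).

Definition well_posed Sigma p : Prop := forall z0 z1 : R -> R, Xp p z0 z1 ->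
  exists_unique_solution Sigma p z0 z1.

Lemma Xp_zero p (z1 : R -> R) : (1 <= p)%E -> Lp p `]0, 1[ z1 -> Xp p (cst 0) z1.
Proof.
move=> p1 L1; split => //; split => //.
- by apply: continuous_subspaceT => x; exact: cvg_cst.
- exact: Lp0.
- exists (cst 0); split; first exact: Lp0.
  move=> phi _.
  have z (k : R -> R) : \int[mu]_(x in `]0, 1[) (cst 0 x * k x) = 0.
    under eq_Rintegral do rewrite mul0r.
    by rewrite Rintegral_cst ?mul0r//; exact: leb_itv_mes.
  by rewrite !z oppr0.
Qed.

(** The data z0 = 0 and z1 = sqrt 2 * f make [g] odd on ]-1, 1[ with
    g(- x) = f(x); the boundary condition at time 1 - x then relates f(x) to
    g(2 - x). *)
Lemma trace_response Sigma p f : (1 <= p)%E -> well_posed Sigma p -> Lp p `]0, 1[ f ->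
  exists2 k, Lp p `]0, 1[ k & {ae mu, forall x, 0 < x < 1 -> rot Sigma (f x, k x)}.
Proof.
move=> p1 solvable Lf; have r0 := lt0r_neq0 (@sqrt2_gt0 R).
have Lz : Lp p `]0, 1[ (fun x => sqrt2 * f x) by exact: LpZ.
have [z [wz _]] := solvable _ _ (Xp_zero p1 Lz).
have [g [[gl gS gI] _]] := wave_trace_solution p1 wz.
(* The boundary condition at t = 1 - x relates g (- x) to g (2 - x). *)
exists (g \o aff (-1) 2).
  have L12 : Lp p `]1, 2[ g by apply: Lploc_Lp gl => //; lra.
  have := Lp_aff 2 p1 (or_intror erefl) (leb_itv_mes _) L12.
  have e2 : 2 - 1 = 1 :> R by ring.
  by rewrite preimage_aff_opp subrr e2.
(* The position z0 = 0 forces [g] to be odd near 0. *)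
have odd : {ae mu, forall x, 0 < x < 1 -> g (- x) + g x = 0}.
  apply: vanishing_ae; first exact: (profile0E p1 gl ltr01 (lexx 1)).1.
  apply: aeS gI => x gx x01; have /andP[x0 x1] := x01.
  have [_] := profile0E p1 gl x0 (ltW x1); have [-> _] := gx x01.
  rewrite -[in LHS]oppr0 => /oppr_inj /esym/eqP.
  by rewrite mulf_eq0 invr_eq0 (negbTE r0)/= => /eqP.
have trace := ae_aff 1 (or_intror erefl) gS.
apply: aeS2 odd (ae_and gI trace) => x ox [gx Sx] x01.
have [_ E] := gx x01; have o := ox x01.
have Ef : g (- x) = f x.
  have E2 : g (- x) - g x = 2 * f x.
    by rewrite -(@sqrt2_sq R) -mulrA -E mulrCA mulfV ?mulr1.
  by clear -E2 o; lra.
have := Sx; rewrite /aff /= -Ef.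
have -> : -1 * x + 1 - 1 = - x by ring.
have -> : -1 * x + 1 + 1 = -1 * x + 2 by ring.
by apply; case/andP: x01 => _ x1; clear -x1; lra.
Qed.

(** Constant functions are in L^p(0, 1), and a relation that holds a.e. holds at
    some point. *)
Lemma trace_total Sigma p : (1 <= p)%E -> well_posed Sigma p ->
  forall c, exists y, rot Sigma (c, y).
Proof.
move=> p1 wp c; have [|k _ hk] := trace_response (f := cst c) p1 wp.
  by apply: Lp_cst => //; [exact: leb_itv_mes|exact: itv_lty].
have [x [x01 /(_ x01) Sx]] := ae_exists ltr01 hk.
by exists (k x).
Qed.

Lemma sign_step_mfun a b (i : interval R) :
  mfun [set` i] (fun s => if s < 0 then a else b).
Proof.
apply: borel_mfun; first exact: measurable_itv.
apply: measurable_funTS; apply: measurable_fun_ifT => //.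
exact: measurable_fun_ltr.
Qed.

(** Consider the data for which [g] is [c] on ]-1, 0[ and [- c] on ]0, 1[, and
    two selections of the boundary relation that differ at [c] only. As [g]
    takes two values on ]-1, 1[, it takes at most two on each later block
    and is measurable, whatever the selections. The recursion thus gives
    solutions for which [g] is [y1], respectively [y2], on ]1, 2[, and the value
    of the solution at t = 3 / 2, x = 1 / 2 distinguishes them. *)
Lemma trace_functional Sigma p c (y1 y2 : R) : (1 <= p)%E -> well_posed Sigma p ->
  rot Sigma (c, y1) -> rot Sigma (c, y2) -> y1 = y2.
Proof.
move=> p1 solvable; set S := rot Sigma => S1 S2.
have total := trace_total p1 solvable.
pose psi x := projT1 (cid (total x)).
have psiP x : S (x, psi x) by exact: projT2 (cid (total x)).
pose sel y x := if x == c then y else psi x.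
have selP y : S (c, y) -> forall x, S (x, sel y x).
  by move=> Sy x; rewrite /sel; case: eqVneq => [->|_].
pose g0 s := if s < 0 then c else - c.
pose z1 : R -> R := cst ((c + c) / sqrt2).
have Lz : Lp p `]0, 1[ z1 by apply: Lp_cst => //; [exact: leb_itv_mes|exact: itv_lty].
have sol y : S (c, y) -> trace_solution S p (cst 0) z1 (unroll (sel y) g0).
  move=> Sy.
  have gl : Lploc p (-1) (unroll (sel y) g0).
    apply: unroll_Lploc => // n.
    apply: (@Lp_bounded _ p _ _ (Num.max `|iter n (sel y) c| `|iter n (sel y) (- c)|)) => //.
    - exact: leb_itv_mes.
    - by rewrite leb_itvE/=; case: ifP => // _; rewrite -EFinB ltry.
    - have -> : iter n (sel y) \o g0 = fun s => if s < 0 then iter n (sel y) c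
          else iter n (sel y) (- c).
        by apply/funext => s; rewrite /= /g0; case: ifP.
      exact: sign_step_mfun.
    - move=> s _; rewrite /= /g0; case: ifP => _; rewrite le_max lexx ?orbT//.
  have small x : 0 < x < 1 -> (unroll (sel y) g0 x = - c) *
      (unroll (sel y) g0 (- x) = c).
    move=> /andP[x0 x1]; rewrite !unroll0.
    + by rewrite /g0 oppr_lt0 x0 ltNge (ltW x0).
    + by clear -x0 x1; apply/andP; split; lra.
    + by clear -x0 x1; apply/andP; split; lra.
  split => //.
  - apply: aeT => t t0.
    have -> : t + 1 = (t - 1) + 2 by ring.
    by rewrite unrollS; [exact: selP|clear -t0; lra].
  - apply: aeT => x x01; split; last by rewrite !(small x x01) opprK.
    have /andP[x0 x1] := x01.
    rewrite (profile0E p1 gl x0 (ltW x1)).2 (@eq_Rintegral _ _ _ mu _ (cst 0)).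
      by rewrite Rintegral_cst ?mul0r ?mulr0 ?oppr0//; exact: leb_itv_mes.
    move=> s /set_mem; rewrite /= in_itv/= => /andP[s0 sx].
    by rewrite !(small s) ?subrr// s0 (lt_trans sx)//; case/andP: x01.
have [z [_ zu]] := solvable _ _ (Xp_zero p1 Lz).
have val y : S (c, y) -> z (3 / 2) (2^-1) = - (sqrt2^-1 * y).
  move=> Sy; rewrite -(zu _ (trace_solution_wave p1 (sol y Sy))); last 2 first.
  - by lra.
  - by apply/andP; split; lra.
  rewrite /profile; congr (- (_ * _)).
  have -> : 3 / 2 - 2^-1 = 1 :> R by lra.
  have -> : 3 / 2 + 2^-1 = 2 :> R by lra.
  rewrite (@eq_Rintegral _ _ _ mu _ (cst y)).
    rewrite Rintegral_cst; last exact: leb_itv_mes.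
    by rewrite leb_oo/=; lra.
  move=> s /set_mem; rewrite /= in_itv/= => /andP[s1 s2].
  rewrite -[s](subrK 2) unrollS; last by clear -s1; lra.
  rewrite unroll0; last by clear -s1 s2; apply/andP; split; lra.
  by rewrite /g0 subr_lt0 s2 /sel eqxx.
have r0 : sqrt2^-1 != 0 by rewrite invr_eq0 lt0r_neq0// sqrt2_gt0.
have := val y1 S1; rewrite (val y2 S2) => /oppr_inj /(mulfI r0).
by [].
Qed.

Lemma solvable_graph Sigma p : (1 <= p)%E -> well_posed Sigma p ->
  exists phi, rot Sigma = fun_graph phi /\
  forall f, Lp p `]0, 1[ f -> Lp p `]0, 1[ (phi \o f).
Proof.
move=> p1 wp; have total := trace_total p1 wp.
exists (fun x => projT1 (cid (total x))).
set phi := fun x => _.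
have phiP x : rot Sigma (x, phi x) by exact: projT2 (cid (total x)).
split.
  apply/seteqP; split => -[x y]; rewrite /fun_graph /=.
    by move=> Sxy; exact: (trace_functional p1 wp Sxy (phiP x)).
  by move=> yE; rewrite yE; exact: (phiP x).
move=> f Lf; have [k Lk hk] := trace_response p1 wp Lf.
apply: (Lp_ae p1 (leb_itv_mes _) _ Lk).
apply: aeS hk => x hk; rewrite /= in_itv/= => x01.
exact: trace_functional p1 wp (hk x01) (phiP _).
Qed.

End Necessity.

(** * The characterization of well-posedness *)

Theorem theorem21 (R : realType) (Sigma : set (R * R)) (p : \bar R)
    (hp : (1 <= p)%E) :
  (forall z0 z1 : R -> R, Xp p z0 z1 -> exists_unique_solution Sigma p z0 z1) <->
  ((p < +oo)%E /\
     (exists phi : R -> R, [/\ universally_measurable_fun phi,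
        linear_growth phi & (@rot45 R) @` Sigma = fun_graph phi])) \/
  (p = +oo%E /\
     (exists phi : R -> R, [/\ universally_measurable_fun phi,
        bounded_to_bounded phi & (@rot45 R) @` Sigma = fun_graph phi])).
Proof.
have Dm := @leb_itv_mes R `[-1, 1[.
have Doo : (leb R `[(-1)%R, 1%R[%classic < +oo)%E.
  by rewrite leb_itvE/=; case: ifP => // _; rewrite -EFinB ltry.
split=> [solv|[[poo [phi [um lin SE]]]|[pE [phi [um bb SE]]]] z0 z1 X].
- have [phi [SE stab]] := solvable_graph hp solv.
  have um := stable_universally_measurable hp stab.
  case: p hp stab {solv} => [r r1|_|//] stab; [left|right].
    split; first exact: ltry.
    by exists phi; split => //; exact: (stable_linear_growth r1 stab).
  by split=> //; exists phi; split => //; exact: stable_bounded.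
- apply: (graph_solvable hp SE _ X) => f Lf.
  exact: (linear_growth_stable hp Dm Doo um lin Lf).
- subst p; apply: (graph_solvable hp SE _ X) => f Lf.
  exact: (bounded_to_bounded_stable Dm Doo um bb Lf).
Qed.
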